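(* Let $n\geq 1$. Bisectors in quaternionic hyperbolic space $\mathbf{H}_{\mathbf{Q}}^n$ admit non-trivial deformations preserving minimality. Namely, each bisector in $\mathbf{H}_{\mathbf{Q}}^n$ belongs to an analytic one-parameter family of minimal hypersurfaces of $\mathbf{H}_{\mathbf{Q}}^n$ such that no other member in the family is a bisector.
   Context: $\mathbf{Q}$ denotes the quaternions. On the right $\mathbf{Q}$-module $\mathbf{Q}^{n+1}$ of column vectors consider $\langle X,Y\rangle=\bar X_1Y_1+\cdots+\bar X_nY_n-\bar X_{n+1}Y_{n+1}$, and let $V_-=\{X:\langle X,X\rangle<0\}$. Quaternionic hyperbolic space $\mathbf{H}_{\mathbf{Q}}^n$ is the projectivization $\mathbf{P}V_-$. In affine coordinates $x_l=X_lX_{n+1}^{-1}$ ($l=1,\dots,n$) it is identified with the unit disc $\{x\in\mathbf{Q}^n:|x|<1\}$, with Riemannian metric $ds^2=4\,\frac{(1-|x|^2)|dx|^2+|(dx,x)|^2}{(1-|x|^2)^2}$, where $(x,y)=\sum_l\bar x_ly_l$ and $|x|^2=(x,x)$; the distance function is $d(x,y)=2\,\mathrm{arccosh}\frac{|1-(x,y)|}{\sqrt{(1-|x|^2)(1-|y|^2)}}$. For two distinct points $p_1,p_2\in\mathbf{H}_{\mathbf{Q}}^n$ the bisector $\mathcal{B}(p_1,p_2)$ is $\{p\in\mathbf{H}_{\mathbf{Q}}^n:d(p,p_1)=d(p,p_2)\}$, a real hypersurface; a bisector is a set of this form. Minimal means vanishing mean curvature. ''Analytic one-parameter family'' means a family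 of hypersurfaces indexed by a real parameter and depending real-analytically on it. *)

(* Defs.v *)
From HB Require Import structures.
From mathcomp Require Import all_boot all_order all_algebra.
From mathcomp Require Import all_classical all_reals all_analysis.

Set Implicit Arguments.
Unset Strict Implicit.
Unset Printing Implicit Defensive.

Import Order.TTheory GRing.Theory Num.Theory.
Import numFieldNormedType.Exports.

Local Open Scope classical_set_scope.
Local Open Scope ring_scope.

(** Quaternions: q 0 0, ..., q 0 3 are the coordinates on 1, i, j, k. *)

Definition quat (R : realType) := 'rV[R]_4.

Definition mkquat (R : realType) (a b c d : R) : quat R :=
  \row_j [:: a; b; c; d]`_j.

Definition qcoord (R : realType) (q : quat R) (j : nat) : R := q 0 (inord j).

Definition qre (R : realType) (q : quat R) : R := qcoord q 0.

Definition qone (R : realType) : quat R := mkquat 1 0 0 0.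

Definition qconj (R : realType) (q : quat R) : quat R :=
  mkquat (qcoord q 0) (- qcoord q 1) (- qcoord q 2) (- qcoord q 3).

Definition qmul (R : realType) (p q : quat R) : quat R :=
  let a := qcoord p in let b := qcoord q in
  mkquat (a 0 * b 0 - a 1 * b 1 - a 2 * b 2 - a 3 * b 3)
         (a 0 * b 1 + a 1 * b 0 + a 2 * b 3 - a 3 * b 2)
         (a 0 * b 2 - a 1 * b 3 + a 2 * b 0 + a 3 * b 1)
         (a 0 * b 3 + a 1 * b 2 - a 2 * b 1 + a 3 * b 0).

Definition qnorm (R : realType) (q : quat R) : R :=
  Num.sqrt (\sum_j q 0 j ^+ 2).

(** Q^n as the real vector space R^(4n); the l-th quaternionic coordinate is
    the l-th row of the n x 4 matrix [vec_mx x]. *)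

Definition qvec (R : realType) (n : nat) := 'rV[R]_(n * 4).

Definition qcomp (R : realType) (n : nat) (x : qvec R n) (l : 'I_n) : quat R :=
  row l (vec_mx x).

Definition hprod (R : realType) (n : nat) (x y : qvec R n) : quat R :=
  \sum_(l < n) qmul (qconj (qcomp x l)) (qcomp y l).

(** (x, x) is a real quaternion. *)
Definition sqnorm (R : realType) (n : nat) (x : qvec R n) : R :=
  qre (hprod x x).

(** Quaternionic hyperbolic n-space in affine coordinates
    x_l = X_l X_(n+1)^-1. *)
Definition qhyp (R : realType) (n : nat) : set (qvec R n) :=
  [set x | sqnorm x < 1].

(** The metric ds^2 = 4 ((1 - |x|^2) |dx|^2 + |(dx, x)|^2) / (1 - |x|^2)^2,
    polarized: Re (conj p * q) is the real inner product whose quadratic form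
    is |q|^2. *)
Definition metric (R : realType) (n : nat) (x u v : qvec R n) : R :=
  4 * ((1 - sqnorm x) * qre (hprod u v)
       + qre (qmul (qconj (hprod u x)) (hprod v x))) / (1 - sqnorm x) ^+ 2.

Definition arccosh (R : realType) (t : R) : R :=
  ln (t + Num.sqrt (t ^+ 2 - 1)).

Definition hdist (R : realType) (n : nat) (x y : qvec R n) : R :=
  2 * arccosh (qnorm (qone R - hprod x y)
               / Num.sqrt ((1 - sqnorm x) * (1 - sqnorm y))).

Definition bisector (R : realType) (n : nat) (p1 p2 : qvec R n) :
    set (qvec R n) :=
  [set p | qhyp p /\ hdist p p1 = hdist p p2].

Definition is_bisector (R : realType) (n : nat) (B : set (qvec R n)) : Prop :=
  exists p1 p2 : qvec R n,
    [/\ qhyp p1, qhyp p2, p1 <> p2 & B = bisector p1 p2].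

(** Real-analytic functions of m real variables: near [a], [f] is the sum of
    an absolutely convergent power series, summed here by total degree. *)

Definition monomial (R : realType) (m : nat) (x : 'rV[R]_m)
    (alpha : 'I_m -> nat) : R :=
  \prod_(i < m) x 0 i ^+ alpha i.

Definition homog_part (R : realType) (m : nat) (c : ('I_m -> nat) -> R)
    (x : 'rV[R]_m) (k : nat) : R :=
  \sum_(alpha : {ffun 'I_m -> 'I_k.+1} | (\sum_(i < m) alpha i == k)%N)
     c (fun i => alpha i) * monomial x (fun i => alpha i).

Definition analytic_at (R : realType) (m : nat) (f : 'rV[R]_m -> R)
    (a : 'rV[R]_m) : Prop :=
  exists (c : ('I_m -> nat) -> R) (r : R), 0 < r /\
    forall x : 'rV[R]_m, (forall i, `|x 0 i - a 0 i| < r) ->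
      cvgn (series (homog_part (fun alpha => `|c alpha|)
                               (\row_i `|x 0 i - a 0 i|))) /\
      series (homog_part c (x - a)) @ \oo --> f x.

(** Hypersurfaces are connected, nonempty, embedded and closed in hyperbolic
    space: a regular local equation is required around every point of the
    ambient space, not only around the points of [M]. Without closedness and
    connectedness one could "deform" a hypersurface by shrinking its domain or
    by letting a further component come in from infinity. *)
Definition hypersurface (R : realType) (n : nat) (M : set (qvec R n)) : Prop :=
  [/\ M `<=` @qhyp R n,
      M !=set0,
      connected M &
      forall p, qhyp p -> exists F : qvec R n -> R,
        [/\ analytic_at F p,
            \forall x \near p, M x <-> F x = 0 &
            M p -> exists v : qvec R n, 'D_v F p != 0]].

Definition tangent (R : realType) (n : nat) (M : set (qvec R n))
    (p : qvec R n) : set (qvec R n) :=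
  [set v | exists gamma : R -> qvec R n,
     [/\ gamma 0 = p, is_derive (0 : R) 1 gamma v &
         \forall s \near (0 : R), M (gamma s)]].

Definition unit_normal (R : realType) (n : nat) (M : set (qvec R n))
    (x w : qvec R n) : Prop :=
  metric x w w = 1 /\ forall v, tangent M x v -> metric x w v = 0.

(** Christoffel symbols of the first kind: for constant fields u, v, w the
    Levi-Civita connection has
    2 g(nabla_u v, w) = D_u g(v, w) + D_v g(u, w) - D_w g(u, v). *)
Definition christoffel (R : realType) (n : nat) (p u v w : qvec R n) : R :=
  2^-1 * ('D_u (fun x => metric x v w) p
          + 'D_v (fun x => metric x u w) p
          - 'D_w (fun x => metric x u v) p).

(** g(nabla_u Y, w) at p, for a vector field Y. *)
Definition covder (R : realType) (n : nat) (Y : qvec R n -> qvec R n)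
    (p u w : qvec R n) : R :=
  metric p ('D_u Y p) w + christoffel p u (Y p) w.

Definition second_fundamental_form (R : realType) (n : nat)
    (nu : qvec R n -> qvec R n) (p u v : qvec R n) : R :=
  - covder nu p u v.

Definition orthonormal_frame (R : realType) (n : nat) (M : set (qvec R n))
    (p : qvec R n) (e : 'I_(n * 4).-1 -> qvec R n) : Prop :=
  (forall i, tangent M p (e i)) /\
  (forall i j, metric p (e i) (e j) = (i == j)%:R).

(** Trace of the second fundamental form, computed in the orthonormal tangent
    frame [e] (on which it does not depend). *)
Definition mean_curvature (R : realType) (n : nat)
    (nu : qvec R n -> qvec R n) (p : qvec R n)
    (e : 'I_(n * 4).-1 -> qvec R n) : R :=
  \sum_i second_fundamental_form nu p (e i) (e i).

(** [nu] is an arbitrary extension of a local unit normal field along [M];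
    replacing [nu] by another choice changes the mean curvature at most by
    its sign. *)
Definition minimal_hypersurface (R : realType) (n : nat)
    (M : set (qvec R n)) : Prop :=
  hypersurface M /\
  forall p, M p -> exists nu : qvec R n -> qvec R n,
    [/\ differentiable nu p,
        \forall x \near p, M x -> unit_normal M x (nu x) &
        forall e, orthonormal_frame M p e -> mean_curvature nu p e = 0].

(** The pair (t, x) is encoded as [row_mx t%:M x] in R^(1 + 4n); the family is
    cut out locally, around every (t, p), by one equation F(t, x) = 0 which is
    analytic in (t, x) jointly and regular in x. *)
Definition analytic_family (R : realType) (n : nat)
    (M : R -> set (qvec R n)) : Prop :=
  forall (t : R) (p : qvec R n), qhyp p ->
    exists F : 'rV[R]_(1 + n * 4) -> R,
      [/\ analytic_at F (row_mx t%:M p),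
          \forall z \near (row_mx t%:M p : 'rV[R]_(1 + n * 4)),
            M (lsubmx z 0 0) (rsubmx z) <-> F z = 0 &
          M t p ->
            exists v : qvec R n, 'D_(row_mx 0 v) F (row_mx t%:M p) != 0].

(* Main.v *)
Require Import Defs.
From HB Require Import structures.
From mathcomp Require Import all_boot all_order all_algebra.
From mathcomp Require Import all_classical all_reals all_analysis.
From mathcomp Require Import ring lra.

Set Implicit Arguments.
Unset Strict Implicit.
Unset Printing Implicit Defensive.
Import Order.TTheory GRing.Theory Num.Theory.
Import numFieldNormedType.Exports.
Local Open Scope classical_set_scope.
Local Open Scope ring_scope.

(** A bisector lies over a hyperplane of a real hyperbolic 4-space, and that
    hyperplane can be bent into helicoids.

    The centres [p1], [p2] of a bisector span a quaternionic line [L], a copy of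
    real hyperbolic 4-space, and the bisector is the preimage of a totally
    geodesic hyperplane of [L] under the orthogonal projection to [L]. A basis
    [E], [F] of null vectors with [<E,F> = 1] can be chosen in the vector space
    of [L] such that in the half-space coordinate [y = <E,X> <F,X>^-1], whose
    real part [y_0] is negative, this hyperplane is [y_2 = 0]
    ([null_pair_bisector]). The family consists of the preimages of
        [y_2 cos (t y_1) = y_3 sin (t y_1)].
    In Euclidean 4-space this is the product of a helicoid of pitch governed by
    [t] with the [y_0]-line, hence minimal. Since it is invariant along [y_0],
    the conformal factor of the hyperbolic metric, which depends on [y_0] alone,
    contributes nothing to its mean curvature.

    Minimality of the preimage is a direct computation. A quaternion [c] has a
    horizontal lift [hor_field c], which projects to a positive multiple of [c],
    and the scalar products of these lifts are a common multiple of the Euclidean ones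
    ([metric_hor_fields]): the projection is horizontally conformal. The gradient
    of the defining function is, up to a positive factor, the lift of the
    Euclidean gradient of the helicoid ([metric_grad_field_diff]). Its covariant
    derivative along [u], paired with [u], involves [u] only through the
    derivative [dhalfsp u] of the projection and the form [shape_q]
    ([nabla_hor_field]). Parseval's identity then turns the trace over the
    tangent frame into a trace over the four basis quaternions and a normal
    term ([trace_shape_q]); both vanish by [helicoid_trace0].

    Each member is connected, as the continuous image of the ball under the
    projection to the bisector followed by rotations of the plane of [y_2] and
    [y_3] by an angle proportional to [y_1] ([helicoidE]). For [t] nonzero it
    is not a bisector: on [L] any bisector has an equation
    [r |y|^2 + b.y + s = 0] ([bisector_axis]), and the helicoid contains enough
    points to make all its coefficients vanish ([helicoid_not_bisector]).

    The defining functions are analytic in [(t, x)] because they are built by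
    ring operations, inversion, cosine and sine, under which convergent
    expansions into homogeneous forms are stable ([analytic0M], [analytic0V],
    [analytic0_cos_sin]). *)

(** * Cauchy products of series *)

Section CauchyProduct.
Variable R : realType.
Implicit Types u v M l : nat -> R.

Lemma series_tail_small M (e : R) : (forall i, 0 <= M i) -> cvgn (series M) ->
  0 < e -> exists K, forall N, (K <= N)%N -> \sum_(K <= i < N) M i < e.
Proof.
move=> M0 Mcvg e0; have /cvgrPdist_lt/(_ e e0)[K _ KP] := Mcvg.
exists K => N KN; have := KP K (leqnn K); rewrite /= => hK.
have le_lim : series M N <= limn (series M).
  apply: nondecreasing_cvgn_le => //.
  by apply/nondecreasing_seqP => n; rewrite seriesSr lerDl.
have : series M N - series M K <= `|limn (series M) - series M K|.
  by apply: le_trans (ler_norm _); rewrite lerD2r.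
by rewrite sub_series_geq // => /le_lt_trans; apply.
Qed.

(** Tannery's theorem: the tails are uniformly small by domination, and the
    heads are finite sums. *)
Lemma series_dominated (a : nat -> nat -> R) M l :
  (forall N i, `|a N i| <= M i) -> cvgn (series M) ->
  (forall i, a ^~ i @ \oo --> l i) ->
  (fun N => \sum_(0 <= i < N) a N i) @ \oo --> limn (series l) /\
  cvgn (series l).
Proof.
move=> aM Mcvg al.
have M0 i : 0 <= M i by exact: le_trans (aM 0%N i).
have lM i : `|l i| <= M i.
  have h : (fun N => `|a N i|) @ \oo --> `|l i| by apply: cvg_norm; exact: al.
  rewrite -(cvg_lim _ h) //; apply: limr_le; first exact: cvgP h.
  by apply: nearW => N.
have lcvg : cvgn (series l).
  by apply: normed_cvg; apply: series_le_cvg lM Mcvg => //.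
split=> //; apply/cvgrPdist_lt => e e0.
have e4 : 0 < e / 4 by rewrite divr_gt0.
have [K KP] := series_tail_small M0 Mcvg e4.
have head : (fun N => \sum_(0 <= i < K) `|l i - a N i|) @ \oo --> (0 : R).
  elim: K {KP} => [|K IH].
    by rewrite (_ : (fun N => _) = cst 0); [exact: cvg_cst | apply/funext => N; rewrite big_geq].
  have hK : (fun N => `|l K - a N K|) @ \oo --> (0 : R).
    rewrite -(normr0 R) -(subrr (l K)); apply: cvg_norm.
    by apply: cvgB; [exact: cvg_cst | exact: al].
  rewrite (_ : (fun N => _) =
      (fun N => \sum_(0 <= i < K) `|l i - a N i|) \+ (fun N => `|l K - a N K|)).
    by have h := cvgD IH hK; rewrite addr0 in h; exact: h.
  by apply/funext => N; rewrite big_nat_recr.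
have /cvgrPdist_lt/(_ _ e4) headN := head.
have /cvgrPdist_lt/(_ _ e4) limN := lcvg.
near=> N.
have KN : (K <= N)%N by near: N; exact: nbhs_infty_ge.
have h1 : `|limn (series l) - series l N| < e / 4 by near: N.
have h2 : `|0 - \sum_(0 <= i < K) `|l i - a N i| | < e / 4 by near: N.
have h3 : `|series l N - \sum_(0 <= i < N) a N i| <=
    \sum_(0 <= i < K) `|l i - a N i| + 2 * \sum_(K <= i < N) M i.
  rewrite /series /= -sumrB (big_cat_nat (n := K)) //=.
  apply: le_trans (ler_normD _ _) _; apply: lerD; first exact: ler_norm_sum.
  apply: le_trans (ler_norm_sum _ _ _) _; rewrite mulr_sumr; apply: ler_sum => i _.
  by apply: le_trans (ler_normB _ _) _; rewrite mulrDl mul1r lerD.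
have := KP _ KN.
rewrite sub0r normrN ger0_norm ?sumr_ge0 // in h2 => h4.
have -> : limn (series l) - \sum_(0 <= i < N) a N i =
  (limn (series l) - series l N) + (series l N - \sum_(0 <= i < N) a N i) by ring.
apply: le_lt_trans (ler_normD _ _) _.
lra.
Unshelve. all: by end_near. Qed.

Definition cauchy_prod (A : pzRingType) (u v : nat -> A) (k : nat) : A :=
  \sum_(0 <= i < k.+1) u i * v (k - i)%N.

Lemma series_cauchy_prod u v N :
  series (cauchy_prod u v) N = \sum_(0 <= i < N) u i * series v (N - i)%N.
Proof.
elim: N => [|N IH]; first by rewrite /series /= !big_geq.
rewrite seriesSr IH /cauchy_prod [X in _ + X = _]big_nat_recr //= addrA -big_split /=.
rewrite [RHS]big_nat_recr //= subSnn subnn; congr (_ + _); last first.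
  by rewrite /series /= big_nat1.
apply: eq_big_nat => i /andP[_ iN]; rewrite -mulrDr subSn; last exact: ltnW.
by rewrite seriesSr.
Qed.

Lemma cauchy_prod_ge0 u v k : (forall i, 0 <= u i) -> (forall i, 0 <= v i) ->
  0 <= cauchy_prod u v k.
Proof. by move=> u0 v0; apply: sumr_ge0 => i _; rewrite mulr_ge0. Qed.

Lemma series_cauchy_prod_le u v N : (forall i, 0 <= u i) -> (forall i, 0 <= v i) ->
  series (cauchy_prod u v) N <= series u N * series v N.
Proof.
move=> u0 v0; rewrite series_cauchy_prod mulr_suml.
apply: ler_sum => i _; apply: ler_wpM2l => //.
have : {homo series v : n m / (n <= m)%N >-> n <= m}.
  by apply/nondecreasing_seqP => n; rewrite seriesSr lerDl.
by apply; rewrite leq_subr.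
Qed.

(** The partial sums of the product are [sum_i u_i * series v (N - i)], whose
    terms are dominated because the partial sums of [v] are bounded. *)
Lemma cvg_cauchy_prod u v (U V : nat -> R) (x y : R) :
  (forall i, `|u i| <= U i) -> (forall i, `|v i| <= V i) ->
  cvgn (series U) -> cvgn (series V) ->
  series u @ \oo --> x -> series v @ \oo --> y ->
  series (cauchy_prod u v) @ \oo --> x * y.
Proof.
move=> uU vV Ucvg Vcvg ux vy.
have U0 i : 0 <= U i by exact: le_trans (uU i).
have V0 i : 0 <= V i by exact: le_trans (vV i).
have VB n : `|series v n| <= limn (series V).
  apply: le_trans (_ : series V n <= _).
    by apply: le_trans (ler_norm_sum _ _ _) _; apply: ler_sum => i _.
  by apply: nondecreasing_cvgn_le => //; apply/nondecreasing_seqP => m; rewrite seriesSr lerDl.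
have [||| dom _] := @series_dominated (fun N i => u i * series v (N - i)%N)
  (fun i => U i * limn (series V)) (fun i => u i * y).
- by move=> N i; rewrite normrM ler_pM.
- rewrite (_ : series _ = (fun N => series U N * limn (series V))); last first.
    by apply/funext => N; rewrite /series /= mulr_suml.
  by apply: is_cvgM => //; exact: is_cvg_cst.
- by move=> i; apply: cvgM; [exact: cvg_cst | apply: (cvg_comp _ _ (cvg_subnr i) vy)].
have -> : series (cauchy_prod u v) =
    (fun N => \sum_(0 <= i < N) u i * series v (N - i)%N).
  by apply/funext => N; rewrite series_cauchy_prod.
suff <- : limn (series (fun i => u i * y)) = x * y by exact: dom.
apply/cvg_lim => //; rewrite (_ : series _ = (fun N => series u N * y)); last first.
  by apply/funext => N; rewrite /series /= mulr_suml.
by apply: cvgM => //; exact: cvg_cst.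
Qed.

End CauchyProduct.

(** * Homogeneous forms as lists of words *)
Section HomogeneousForms.
Variables (R : realType) (m : nat).
Implicit Types (x : 'rV[R]_m) (w : seq 'I_m) (s : seq (R * seq 'I_m)).

Definition word_val x w : R := \prod_(i <- w) x 0 i.

Definition words_val s x : R := \sum_(p <- s) p.1 * word_val x p.2.

(** A form is kept as a list of weighted words in the variables: words multiply
    by concatenation and repetitions are harmless, so that no multinomial
    coefficient appears. [B] is the majorant that such a list provides on the
    unit polydisc. *)
Definition homog_form (k : nat) (f : 'rV[R]_m -> R) (B : R) : Prop :=
  exists s, [/\ all (fun p => size p.2 == k) s, f =1 words_val s &
                B = \sum_(p <- s) `|p.1|].

Lemma word_val_le (r : R) x w : (forall i, `|x 0 i| <= r) ->
  `|word_val x w| <= r ^+ size w.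
Proof.
move=> xr; rewrite /word_val; elim: w => [|i w IH]; first by rewrite big_nil normr1.
by rewrite big_cons normrM exprS ler_pM.
Qed.

Lemma homog_form_ge0 k f B : homog_form k f B -> 0 <= B.
Proof. by move=> [s [_ _ ->]]; exact: sumr_ge0. Qed.

Lemma words_val_le (r : R) k s x : all (fun p => size p.2 == k) s ->
  (forall i, `|x 0 i| <= r) -> `|words_val s x| <= (\sum_(p <- s) `|p.1|) * r ^+ k.
Proof.
move=> /allP sk xr; rewrite mulr_suml; apply: le_trans (ler_norm_sum _ _ _) _.
rewrite big_seq [leRHS]big_seq; apply: ler_sum => p ps.
by rewrite normrM ler_wpM2l // -(eqP (sk _ ps)) word_val_le.
Qed.

Lemma homog_form_le k f B (r : R) x : homog_form k f B -> (forall i, `|x 0 i| <= r) ->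
  `|f x| <= B * r ^+ k.
Proof. by move=> [s [sk fs ->]] xr; rewrite fs; apply: words_val_le. Qed.

Lemma homog_form0 k : homog_form k (fun=> 0) 0.
Proof. by exists [::]; split=> // [x|]; rewrite /words_val big_nil. Qed.

Lemma homog_form_const c : homog_form 0 (fun=> c) `|c|.
Proof.
exists [:: (c, [::])]; split=> // [x|]; last by rewrite big_seq1.
by rewrite /words_val big_seq1 /word_val big_nil mulr1.
Qed.

Lemma homog_form_coord i : homog_form 1 (fun x => x 0 i) 1.
Proof.
exists [:: (1, [:: i])]; split=> // [x|]; last by rewrite big_seq1 normr1.
by rewrite /words_val big_seq1 /word_val big_seq1 mul1r.
Qed.

Lemma homog_formD k f g A B : homog_form k f A -> homog_form k g B ->
  homog_form k (fun x => f x + g x) (A + B).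
Proof.
move=> [s [sk fs ->]] [t [tk gt ->]]; exists (s ++ t); split=> [|x|].
- by rewrite all_cat sk.
- by rewrite fs gt /words_val big_cat.
- by rewrite big_cat.
Qed.

Lemma homog_formZ k f B c : homog_form k f B ->
  homog_form k (fun x => c * f x) (`|c| * B).
Proof.
move=> [s [sk fs ->]]; exists [seq (c * p.1, p.2) | p <- s]; split=> [|x|].
- by rewrite all_map.
- by rewrite fs /words_val big_map mulr_sumr; apply: eq_bigr => p _; rewrite mulrA.
- by rewrite big_map mulr_sumr; apply: eq_bigr => p _; rewrite normrM.
Qed.

Lemma homog_formM k l f g A B : homog_form k f A -> homog_form l g B ->
  homog_form (k + l) (fun x => f x * g x) (A * B).
Proof.
move=> [s [/allP sk fs ->]] [t [/allP tl gt ->]].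
exists [seq (p.1 * q.1, p.2 ++ q.2) | p <- s, q <- t]; split=> [|x|].
- apply/allP => _ /allpairsP[[p q] /= [ps qt ->]] /=.
  by rewrite size_cat (eqP (sk _ ps)) (eqP (tl _ qt)).
- rewrite fs gt /words_val big_allpairs_dep mulr_suml; apply: eq_bigr => p _.
  rewrite mulr_sumr; apply: eq_bigr => q _.
  by rewrite /word_val big_cat /= mulrACA.
- rewrite big_allpairs_dep mulr_suml; apply: eq_bigr => p _.
  by rewrite mulr_sumr; apply: eq_bigr => q _; rewrite normrM.
Qed.

Lemma homog_form_sum k N (f : nat -> 'rV[R]_m -> R) (B : nat -> R) :
  (forall j, (j < N)%N -> homog_form k (f j) (B j)) ->
  homog_form k (fun x => \sum_(0 <= j < N) f j x) (\sum_(0 <= j < N) B j).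
Proof.
elim: N => [|N IH] fB.
  by exists [::]; split=> // [x|]; rewrite /words_val ?(big_nil, big_geq).
rewrite big_nat_recr //= (_ : (fun x => _) =
    (fun x => \sum_(0 <= j < N) f j x + f N x)).
  by apply: homog_formD; [apply: IH => j jN; apply: fB; exact: leqW | exact: fB].
by apply/funext => x; rewrite big_nat_recr.
Qed.

Definition same_monomial w (alpha : 'I_m -> nat) : bool :=
  [forall i, count_mem i w == alpha i].

Definition words_coef s (alpha : 'I_m -> nat) : R :=
  \sum_(p <- s | same_monomial p.2 alpha) p.1.

Lemma word_val_count x w : word_val x w = \prod_(i < m) x 0 i ^+ count_mem i w.
Proof.
elim: w => [|j w IH] /=.
  by rewrite /word_val big_nil big1 // => i _; rewrite expr0.
rewrite /word_val big_cons -/(word_val x w) IH.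
under [RHS]eq_bigr do rewrite exprD.
rewrite big_split /=; congr (_ * _); rewrite (bigD1 j) //= eqxx expr1.
by rewrite big1 ?mulr1 // => i /negbTE ij; rewrite eq_sym ij expr0.
Qed.

Lemma sum_count_mem w : (\sum_(i < m) count_mem i w)%N = size w.
Proof.
elim: w => [|j w IH] /=; first by rewrite big1.
rewrite big_split /= IH (bigD1 j) //= eqxx big1 // => i /negbTE ij.
by rewrite eq_sym ij.
Qed.

(** The exponent [alpha] of each word of length [k] is unique, and its entries
    are at most [k]: regrouping words by exponent loses nothing. *)
Lemma homog_part_words k s x : all (fun p => size p.2 == k) s ->
  homog_part (words_coef s) x k = words_val s x.
Proof.
move=> /allP sk; rewrite /homog_part /words_coef.
under eq_bigr do rewrite mulr_suml.
rewrite (exchange_big_dep predT) //= /words_val big_seq [RHS]big_seq.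
apply: eq_bigr => p ps; have pk := eqP (sk _ ps).
have cle i : (count_mem i p.2 < k.+1)%N by rewrite ltnS -pk count_size.
pose al : {ffun 'I_m -> 'I_k.+1} := [ffun i => Ordinal (cle i)].
rewrite (bigD1 al) /=; last first.
  apply/andP; split; last by apply/forallP => i; rewrite ffunE.
  apply/eqP/(etrans _ pk); rewrite -sum_count_mem.
  by apply: eq_bigr => i _; rewrite ffunE.
rewrite big1 ?addr0 => [|be /andP[/andP[_ /forallP bp] /eqP neq]].
  rewrite word_val_count /monomial; congr (_ * _).
  by apply: eq_bigr => i _; rewrite ffunE.
by case: neq; apply/ffunP => i; apply/val_inj; rewrite ffunE /= (eqP (bp i)).
Qed.

(** The coefficients are regrouped before taking absolute values, which can only
    decrease the sum. *)
Lemma homog_part_words_norm (r : R) k s x : all (fun p => size p.2 == k) s ->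
  (forall i, 0 <= x 0 i <= r) ->
  homog_part (fun alpha => `|words_coef s alpha|) x k <= (\sum_(p <- s) `|p.1|) * r ^+ k.
Proof.
move=> sk xr; pose t := [seq (`|p.1|, p.2) | p <- s].
have tk : all (fun p => size p.2 == k) t by rewrite all_map.
have -> : \sum_(p <- s) `|p.1| = \sum_(p <- t) `|p.1|.
  by rewrite big_map; apply: eq_bigr => p _; rewrite normr_id.
apply: (@le_trans _ _ (words_val t x)); last first.
  apply: le_trans (ler_norm _) _; apply: words_val_le => // i.
  by have /andP[x0 xr'] := xr i; rewrite ger0_norm.
rewrite -(homog_part_words x tk); apply: ler_sum => al _; apply: ler_wpM2r.
  by apply: prodr_ge0 => i _; apply: exprn_ge0; have /andP[] := xr i.
by rewrite /words_coef big_map; exact: ler_norm_sum.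
Qed.

End HomogeneousForms.

(** * Powers and substitution of series *)
Section CauchyPower.
Variable R : realType.
Implicit Types (u v : nat -> R).

Fixpoint cauchy_pow u (j : nat) : nat -> R :=
  if j is j'.+1 then cauchy_prod u (cauchy_pow u j') else fun k => (k == 0)%:R.

Lemma cauchy_pow_lt u j k : u 0%N = 0 -> (k < j)%N -> cauchy_pow u j k = 0.
Proof.
move=> u0; elim: j k => // j IH k kj /=; rewrite /cauchy_prod big_nat big1 // => i /andP[_ ik].
case: i ik => [|i] ik; first by rewrite u0 mul0r.
by rewrite IH ?mulr0 // ltn_subLR // addSn ltnS (leq_trans _ (leq_addl _ _)).
Qed.

Lemma cauchy_pow_ge0 u j k : (forall i, 0 <= u i) -> 0 <= cauchy_pow u j k.
Proof.
by move=> u0; elim: j k => [|j IH] k /=; rewrite ?ler0n // cauchy_prod_ge0.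
Qed.

Lemma cauchy_pow_norm u v j k : (forall i, `|u i| <= v i) ->
  `|cauchy_pow u j k| <= cauchy_pow v j k.
Proof.
move=> uv; elim: j k => [|j IH] k /=; first by rewrite normr_nat.
apply: le_trans (ler_norm_sum _ _ _) _; apply: ler_sum => i _.
by rewrite normrM ler_pM.
Qed.

Lemma cauchy_pow_scale u (r : R) j k :
  cauchy_pow (fun i => u i * r ^+ i) j k = cauchy_pow u j k * r ^+ k.
Proof.
elim: j k => [|j IH] k /=; first by case: k => [|k]; rewrite ?mul0r // expr0 mulr1.
rewrite /cauchy_prod mulr_suml; apply: eq_big_nat => i /andP[_ ik].
by rewrite IH mulrACA -exprD subnKC // -ltnS.
Qed.

Lemma series_cauchy_pow_le u (S : R) j N : (forall i, 0 <= u i) ->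
  (forall N, series u N <= S) -> series (cauchy_pow u j) N <= S ^+ j.
Proof.
move=> u0 uS; elim: j => [|j IH] /=.
  rewrite expr0 /series /=; case: N => [|N]; first by rewrite big_geq.
  by rewrite big_nat_recl //= big1 ?addr0.
apply: le_trans (series_cauchy_prod_le _ u0 (fun i => cauchy_pow_ge0 j i u0)) _.
rewrite exprS ler_pM // sumr_ge0 // => i _; exact: cauchy_pow_ge0.
Qed.

Lemma series_ge0_bounded_cvg u (S : R) : (forall i, 0 <= u i) ->
  (forall N, series u N <= S) -> cvgn (series u).
Proof.
move=> u0 uS; apply: nondecreasing_is_cvgn.
  by apply/nondecreasing_seqP => n; rewrite seriesSr lerDl.
by exists S => _ [N _ <-].
Qed.

Lemma cvg_cauchy_pow u v (S x : R) j : (forall i, `|u i| <= v i) ->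
  (forall N, series v N <= S) -> series u @ \oo --> x ->
  series (cauchy_pow u j) @ \oo --> x ^+ j.
Proof.
move=> uv vS ux; have v0 i : 0 <= v i by exact: le_trans (uv i).
elim: j => [|j IH] /=.
  rewrite expr0; apply: cvg_near_cst; exists 1%N => // -[|n] //= _.
  by rewrite /series /= big_nat_recl //= big1 ?addr0.
rewrite exprS; apply: (cvg_cauchy_prod uv _ _ _ ux IH).
- by move=> i; exact: cauchy_pow_norm uv.
- exact: series_ge0_bounded_cvg v0 vS.
apply: (@series_ge0_bounded_cvg _ (S ^+ j)) => [i|N]; first exact: cauchy_pow_ge0.
exact: series_cauchy_pow_le.
Qed.

(** The degree-[k] part of [sum_j a_j U^j] when [U] has no constant term. *)
Definition subst_coef (a u : nat -> R) (k : nat) : R :=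
  \sum_(0 <= j < k.+1) a j * cauchy_pow u j k.

Lemma series_subst_coef a u N : u 0%N = 0 ->
  series (subst_coef a u) N = \sum_(0 <= j < N) a j * series (cauchy_pow u j) N.
Proof.
move=> u0; elim: N => [|N IH]; first by rewrite /series /= !big_geq.
rewrite seriesSr IH [RHS]big_nat_recr //= seriesSr {3}/series /=.
have -> : \sum_(0 <= k < N) cauchy_pow u N k = 0.
  by rewrite big_nat big1 // => k /andP[_ kN]; rewrite cauchy_pow_lt.
rewrite add0r /subst_coef [X in _ + X = _]big_nat_recr //= addrA -big_split /=.
by congr (_ + _); apply: eq_bigr => i _; rewrite seriesSr mulrDr.
Qed.

End CauchyPower.

(** * Analytic functions near the origin *)
Section Expansions.
Variables (R : realType) (m : nat).
Implicit Types (G H : 'rV[R]_m -> R) (f g : nat -> 'rV[R]_m -> R) (B C : nat -> R).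

(** The majorants [B] are carried along: they give absolute convergence on the
    closed polydisc, uniformly, which products and substitutions rely on. *)
Definition expands G (r : R) f B : Prop :=
  [/\ 0 < r, forall k, homog_form k (f k) (B k),
      cvgn (series (fun k => B k * r ^+ k)) &
      forall x : 'rV[R]_m, (forall i, `|x 0 i| < r) -> series (f ^~ x) @ \oo --> G x].

Definition analytic0 G : Prop := exists r f B, expands G r f B.

Lemma majorant_ge0 (r : R) k (f : 'rV[R]_m -> R) (B : R) : 0 <= r ->
  homog_form k f B -> 0 <= B * r ^+ k.
Proof. by move=> r0 fB; rewrite mulr_ge0 ?exprn_ge0 ?(homog_form_ge0 fB). Qed.

Lemma analytic0_at G a : analytic0 (fun h => G (a + h)) -> analytic_at G a.
Proof.
move=> [r [f [B [r0 fB Bcvg fG]]]].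
pose s k := sval (cid (fB k)); have sP k := svalP (cid (fB k)).
exists (fun al => words_coef (s (\sum_(i < m) al i)%N) al), r; split=> // x xr.
have cE (h : R -> R) y k :
    homog_part (fun al => h (words_coef (s (\sum_(i < m) al i)%N) al)) y k =
    homog_part (fun al => h (words_coef (s k) al)) y k.
  by apply: eq_bigr => al /eqP ->.
split.
  apply: (series_le_cvg _ _ _ Bcvg) => k.
  - apply: sumr_ge0 => al _; rewrite mulr_ge0 // prodr_ge0 // => i _.
    by rewrite exprn_ge0 // mxE.
  - exact: majorant_ge0 (ltW r0) (fB k).
  - rewrite cE; have [sk _ ->] := sP k; apply: homog_part_words_norm => // i.
    by rewrite mxE normr_ge0 ltW.
rewrite (_ : homog_part _ _ = f^~ (x - a)).
  rewrite -[X in _ --> G X](subrK a) [_ + a]addrC; apply: fG => i.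
  by rewrite !mxE.
by apply/funext => k; rewrite (cE id); have [sk -> _] := sP k; exact: homog_part_words.
Qed.

Lemma expands_shrink G r s f B : 0 < s <= r -> expands G r f B -> expands G s f B.
Proof.
move=> /andP[s0 sr] [r0 fB Bcvg fG]; split=> // [|x xs]; last first.
  by apply: fG => i; exact: lt_le_trans (xs i) sr.
have B0 k := homog_form_ge0 (fB k).
apply: (series_le_cvg _ _ _ Bcvg) => k.
- exact: majorant_ge0 (ltW s0) (fB k).
- exact: majorant_ge0 (ltW r0) (fB k).
- by rewrite ler_wpM2l // lerXn2r // nnegrE ltW.
Qed.

Lemma analytic0_2 G H : analytic0 G -> analytic0 H ->
  exists r f g B C, expands G r f B /\ expands H r g C.
Proof.
move=> [r [f [B eG]]] [s [g [C eH]]]; exists (Num.min r s), f, g, B, C.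
have [r0 _ _ _] := eG; have [s0 _ _ _] := eH.
by split; [apply: expands_shrink eG | apply: expands_shrink eH];
  rewrite lt_min r0 s0 ge_min lexx ?orbT.
Qed.

Lemma cvg_series_degree (d : nat) (y : R) :
  series (fun k => if k == d then y else 0) @ \oo --> y.
Proof.
apply: cvg_near_cst; near=> N; have dN : (d < N)%N by near: N; exact: nbhs_infty_gt.
rewrite /series /= big_mkord (bigD1 (Ordinal dN)) //= eqxx big1 ?addr0 // => i.
by rewrite -val_eqE /= => /negbTE ->.
Unshelve. all: by end_near. Qed.

Lemma analytic0_homog d G (b : R) : homog_form d G b -> analytic0 G.
Proof.
move=> Gb; exists 1, (fun k x => if k == d then G x else 0), (fun k => if k == d then b else 0).
split=> // [k||x _]; last exact: cvg_series_degree.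
  by case: eqP => [->|_] //; exact: homog_form0.
rewrite (_ : (fun k => _) = (fun k => if k == d then b else 0)).
  by apply: (cvgP b); apply: cvg_series_degree.
by apply/funext => k; rewrite expr1n mulr1.
Qed.

Lemma analytic0_const c : analytic0 (fun=> c).
Proof. exact: analytic0_homog (homog_form_const m c). Qed.

Lemma analytic0_coord i : analytic0 (fun x => x 0 i).
Proof. exact: analytic0_homog (homog_form_coord R i). Qed.

Lemma analytic0D G H : analytic0 G -> analytic0 H -> analytic0 (fun x => G x + H x).
Proof.
move=> aG aH; have [r [f [g [B [C [eG eH]]]]]] := analytic0_2 aG aH.
have [r0 fB Bc fG] := eG; have [_ gC Cc gH] := eH.
exists r, (fun k x => f k x + g k x), (fun k => B k + C k); split=> // [k||x xr].
- exact: homog_formD.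
- rewrite (_ : series _ =
    series (fun k => B k * r ^+ k) \+ series (fun k => C k * r ^+ k)).
    exact: is_cvgD.
  by apply/funext => N; rewrite /series /= -big_split; apply: eq_bigr => k _; rewrite mulrDl.
- rewrite (_ : series _ = series (f ^~ x) \+ series (g ^~ x)).
    by apply: cvgD; [exact: fG | exact: gH].
  by apply/funext => N; rewrite /series /= -big_split.
Qed.

Lemma expands_bound G r f B (x : 'rV[R]_m) k :
  expands G r f B -> (forall i, `|x 0 i| < r) ->
  `|f k x| <= B k * r ^+ k.
Proof.
by move=> [r0 fB _ _] xr; apply: homog_form_le (fB k) _ => i; exact: ltW.
Qed.

Lemma analytic0M G H : analytic0 G -> analytic0 H -> analytic0 (fun x => G x * H x).
Proof.
move=> aG aH; have [r [f [g [B [C [eG eH]]]]]] := analytic0_2 aG aH.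
have [r0 fB Bc fG] := eG; have [_ gC Cc gH] := eH.
have B0 k : 0 <= B k * r ^+ k by exact: majorant_ge0 (ltW r0) (fB k).
have C0 k : 0 <= C k * r ^+ k by exact: majorant_ge0 (ltW r0) (gC k).
exists r, (fun k x => \sum_(0 <= i < k.+1) f i x * g (k - i)%N x), (cauchy_prod B C).
split=> // [k||x xr].
- apply: (@homog_form_sum _ _ k k.+1 (fun i x => f i x * g (k - i)%N x)
    (fun i => B i * C (k - i)%N)) => i ik.
  by rewrite -[X in homog_form X](subnKC (ik : i <= k)%N); exact: homog_formM.
- rewrite (_ : (fun k => _) =
      cauchy_prod (fun k => B k * r ^+ k) (fun k => C k * r ^+ k)).
    have := @cvg_cauchy_prod _ _ _ _ _ _ _
      (fun i => le_refl _) (fun i => le_refl _) _ _ Bc Cc.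
    move=> h; apply: cvgP; apply: h.
      by under eq_fun do rewrite ger0_norm //.
    by under eq_fun do rewrite ger0_norm //.
  apply/funext => k; rewrite /cauchy_prod mulr_suml; apply: eq_big_nat => i /andP[_ ik].
  by rewrite mulrACA -exprD subnKC // -ltnS.
- apply: (@cvg_cauchy_prod _ (f ^~ x) (g ^~ x) _ _ _ _ _ _ Bc Cc); last 2 first.
  + exact: fG.
  + exact: gH.
  + by move=> i; exact: expands_bound eG xr.
  + by move=> i; exact: expands_bound eH xr.
Qed.

Lemma homog_form_cauchy_pow f B j k : (forall k, homog_form k (f k) (B k)) ->
  homog_form k (fun x => cauchy_pow (f ^~ x) j k) (cauchy_pow B j k).
Proof.
move=> fB; elim: j k => [|j IH] k /=.
  case: k => [|k]; last exact: homog_form0.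
  by have := homog_form_const m (1 : R); rewrite normr1.
apply: (@homog_form_sum _ _ k k.+1 (fun i x => f i x * cauchy_pow (f ^~ x) j (k - i)%N)
    (fun i => B i * cauchy_pow B j (k - i)%N)) => i ik.
by rewrite -[X in homog_form X](subnKC (ik : i <= k)%N); exact: homog_formM.
Qed.

(** The inner series starts in degree 1, so each homogeneous part of the
    composite is a finite sum. The majorant [S] of the inner function lies in the
    disc of convergence of the outer series, so the double sum may be
    rearranged. *)
Lemma analytic0_subst H r f B (a : nat -> R) (phi : R -> R) (S : R) :
  expands H r f B -> (forall x, f 0%N x = 0) -> B 0%N = 0 ->
  (forall N, series (fun k => B k * r ^+ k) N <= S) ->
  cvgn (series (fun j => `|a j| * S ^+ j)) ->
  (forall y, `|y| <= S -> series (fun j => a j * y ^+ j) @ \oo --> phi y) ->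
  analytic0 (fun x => phi (H x)).
Proof.
move=> eH f0 B0 BS aS aphi; have [r0 fB Bc fH] := eH.
pose U k := B k * r ^+ k.
have U0 k : 0 <= U k by exact: majorant_ge0 (ltW r0) (fB k).
have S0 : 0 <= S by have := BS 0%N; rewrite /series /= big_geq.
exists r, (fun k x => subst_coef a (f ^~ x) k), (subst_coef (fun j => `|a j|) B).
split=> // [k||x xr].
- apply: (@homog_form_sum _ _ k k.+1 (fun j x => a j * cauchy_pow (f ^~ x) j k)
    (fun j => `|a j| * cauchy_pow B j k)) => j _.
  by apply: homog_formZ; exact: homog_form_cauchy_pow.
- rewrite (_ : (fun k => _) = subst_coef (fun j => `|a j|) U); last first.
    apply/funext => k; rewrite /subst_coef mulr_suml; apply: eq_bigr => j _.
    by rewrite cauchy_pow_scale mulrA.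
  apply: (@series_ge0_bounded_cvg _ _ (limn (series (fun j => `|a j| * S ^+ j)))).
    by move=> k; apply: sumr_ge0 => j _; rewrite mulr_ge0 // cauchy_pow_ge0.
  move=> N; rewrite series_subst_coef ?/U ?B0 ?mul0r //.
  apply: le_trans (_ : series (fun j => `|a j| * S ^+ j) N <= _).
    by apply: ler_sum => j _; rewrite ler_wpM2l // series_cauchy_pow_le.
  apply: nondecreasing_cvgn_le => //; apply/nondecreasing_seqP => n.
  by rewrite seriesSr lerDl mulr_ge0 // exprn_ge0.
- have fU k : `|f k x| <= U k by exact: expands_bound eH xr.
  have Hx : `|H x| <= S.
    have h : (fun N => `|series (f ^~ x) N|) @ \oo --> `|H x| by apply: cvg_norm; exact: fH.
    rewrite -(cvg_lim _ h) //; apply: limr_le; first exact: cvgP h.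
    apply: nearW => N; apply: le_trans (BS N).
    by apply: le_trans (ler_norm_sum _ _ _) _; exact: ler_sum.
  have [|||dom _] := @series_dominated R
    (fun N j => a j * series (cauchy_pow (f ^~ x) j) N) (fun j => `|a j| * S ^+ j)
    (fun j => a j * H x ^+ j).
  + move=> N j; rewrite normrM ler_wpM2l //.
    apply: le_trans (series_cauchy_pow_le j N U0 BS).
    apply: le_trans (ler_norm_sum _ _ _) _; apply: ler_sum => k _.
    exact: cauchy_pow_norm.
  + exact: aS.
  + move=> j; apply: cvgM; first exact: cvg_cst.
    by apply: (@cvg_cauchy_pow _ (f ^~ x) U S (H x) j fU BS); exact: fH.
  rewrite (cvg_lim _ (aphi _ Hx)) // in dom.
  rewrite (_ : series _ = (fun N => \sum_(0 <= j < N) a j * series (cauchy_pow (f ^~ x) j) N)) //.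
  by apply/funext => N; rewrite series_subst_coef.
Qed.

Lemma homog_form_at0 k (f : 'rV[R]_m -> R) (B : R) : homog_form k.+1 f B -> f 0 = 0.
Proof.
move=> fB; apply/eqP; rewrite -normr_le0.
have := homog_form_le fB (r := 0) (x := 0); rewrite expr0n mulr0; apply.
by move=> i; rewrite mxE normr0.
Qed.

Lemma homog_form_deg0 (f : 'rV[R]_m -> R) (B : R) x : homog_form 0 f B -> f x = f 0.
Proof.
move=> [s [/allP s0 fs _]]; rewrite !fs; apply: eq_big_seq => p ps.
by rewrite /word_val (size0nil (eqP (s0 _ ps))) !big_nil.
Qed.

Lemma analytic0_center G : analytic0 G ->
  exists r f B, [/\ expands (fun x => G x - G 0) r f B,
    forall x, f 0%N x = 0 & B 0%N = 0].
Proof.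
move=> [r [f [B [r0 fB Bc fG]]]].
have G0 : G 0 = f 0%N 0.
  have h := @fG 0 (fun i => _); rewrite -(cvg_lim _ (h _)) //; last first.
    by move=> i; rewrite mxE normr0.
  apply: (@cvg_lim _ _ _ _ _ _ _); first exact: norm_hausdorff.
  rewrite (_ : f^~ 0 = (fun k => if k == 0%N then f 0%N 0 else 0)).
    exact: cvg_series_degree.
  by apply/funext => -[|k] //=; exact: homog_form_at0 (fB k.+1).
exists r, (fun k x => if k == 0%N then 0 else f k x), (fun k => if k == 0%N then 0 else B k).
split=> //; split=> // [[|k]||x xr] //=.
- exact: homog_form0.
- apply: (series_le_cvg _ _ _ Bc) => -[|k] /=;
    by rewrite ?mul0r ?lexx ?(majorant_ge0 (ltW r0) (fB _)).
rewrite G0 -(homog_form_deg0 x (fB 0%N)).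
rewrite (_ : series _ = series (f ^~ x) \- series (fun k => if k == 0%N then f 0%N x else 0)).
  by apply: cvgB; [exact: fG | exact: cvg_series_degree].
apply/funext => N; rewrite /series /= -sumrB; apply: eq_bigr => k _.
by case: eqP => [->|_]; rewrite ?subrr ?subr0.
Qed.

Lemma analytic0_entire G (a : nat -> R) (phi : R -> R) : analytic0 G ->
  (forall S, 0 <= S -> cvgn (series (fun j => `|a j| * S ^+ j))) ->
  (forall y, series (fun j => a j * y ^+ j) @ \oo --> phi y) ->
  analytic0 (fun x => phi (G x - G 0)).
Proof.
move=> /analytic0_center[r [f [B [eG f0 B0]]]] aS aphi.
have [r0 fB Bc _] := eG.
have U0 k : 0 <= B k * r ^+ k by exact: majorant_ge0 (ltW r0) (fB k).
have BS N : series (fun k => B k * r ^+ k) N <= limn (series (fun k => B k * r ^+ k)).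
  by apply: nondecreasing_cvgn_le => //; apply/nondecreasing_seqP => n; rewrite seriesSr lerDl.
apply: (analytic0_subst eG f0 B0 BS) => [|y _]; last exact: aphi.
by apply: aS; have := BS 0%N; rewrite /series /= big_geq.
Qed.

(** Substitution needs an inner function that vanishes at the centre; the addition
    formulas take care of the value [G 0]. *)
Lemma analytic0_cos_sin G : analytic0 G ->
  analytic0 (fun x => cos (G x)) /\ analytic0 (fun x => sin (G x)).
Proof.
move=> aG.
have ac : analytic0 (fun x => cos (G x - G 0)).
  apply: (@analytic0_entire G (cos_coeff 1)) => // [S S0|y].
    apply: (series_le_cvg _ _ _ (is_cvg_series_exp_coeff S)) => k;
      rewrite ?mulr_ge0 ?exprn_ge0 ?exp_coeff_ge0 //.
    rewrite /cos_coeff /exp_coeff /= expr1n mulr1 mulrC ler_wpM2l ?exprn_ge0 //.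
    rewrite -exprnP !normrM normrX normrN1 expr1n mulr1 normfV !normr_nat.
    by case: (odd k); rewrite /= ?mul0r ?mul1r ?invr_ge0.
  have := @is_cvg_series_cos_coeff R y; rewrite unlock.
  rewrite (_ : (fun j => _) = cos_coeff y) //; apply/funext => j.
  by rewrite /cos_coeff /= expr1n mulr1 mulrAC.
have as_ : analytic0 (fun x => sin (G x - G 0)).
  apply: (@analytic0_entire G (sin_coeff 1)) => // [S S0|y].
    apply: (series_le_cvg _ _ _ (is_cvg_series_exp_coeff S)) => k;
      rewrite ?mulr_ge0 ?exprn_ge0 ?exp_coeff_ge0 //.
    rewrite /sin_coeff /exp_coeff /= expr1n mulr1 mulrC ler_wpM2l ?exprn_ge0 //.
    rewrite !normrM normrX normrN1 expr1n mulr1 normfV !normr_nat.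
    by case: (odd k); rewrite /= ?mul0r ?mul1r ?invr_ge0.
  have := @is_cvg_series_sin_coeff R y; rewrite unlock.
  rewrite (_ : (fun j => _) = sin_coeff y) //; apply/funext => j.
  by rewrite /sin_coeff /= expr1n mulr1 mulrAC.
split.
  rewrite (_ : (fun x => _) =
    (fun x => cos (G 0) * cos (G x - G 0) + (- sin (G 0)) * sin (G x - G 0))).
    by apply: analytic0D; apply: analytic0M => //; exact: analytic0_const.
  by apply/funext => x; have := cosD (G x - G 0) (G 0); rewrite subrK => ->; ring.
rewrite (_ : (fun x => _) =
  (fun x => sin (G 0) * cos (G x - G 0) + cos (G 0) * sin (G x - G 0))).
  by apply: analytic0D; apply: analytic0M => //; exact: analytic0_const.
by apply/funext => x; have := sinD (G x - G 0) (G 0); rewrite subrK => ->; ring.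
Qed.

(** Shrinking the polydisc makes the majorant of the non-constant part as small
    as needed for the geometric series. *)
Lemma analytic0V G : analytic0 G -> G 0 != 0 -> analytic0 (fun x => (G x)^-1).
Proof.
move=> aG G0.
have aH : analytic0 (fun x => 1 + - (G 0)^-1 * G x).
  by apply: analytic0D; [|apply: analytic0M => //]; exact: analytic0_const.
have [r [f [B [eH f0 B0]]]] := analytic0_center aH.
have [r0 fB Bc _] := eH.
pose U k := B k * r ^+ k.
have U0 k : 0 <= U k by exact: majorant_ge0 (ltW r0) (fB k).
pose L := limn (series U).
have UL N : series U N <= L.
  by apply: nondecreasing_cvgn_le => //; apply/nondecreasing_seqP => n; rewrite seriesSr lerDl.
have L0 : 0 <= L by have := UL 0%N; rewrite {1}/series /= big_geq.
pose q := (2 * (L + 1))^-1.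
have L1 : 0 < 2 * (L + 1) by lra.
have q0 : 0 < q by rewrite invr_gt0.
have q1 : q <= 1 by rewrite invf_le1 //; lra.
have qL : q * L <= 2^-1.
  by rewrite /q ler_pdivrMl //; lra.
have eHs : expands (fun x => 1 + - (G 0)^-1 * G x - (1 + - (G 0)^-1 * G 0)) (q * r) f B.
  by apply: expands_shrink eH; rewrite mulr_gt0 //= ler_piMl // ltW.
suff : analytic0 (fun x => (G 0)^-1 * (1 - (1 + - (G 0)^-1 * G x - (1 + - (G 0)^-1 * G 0)))^-1).
  congr analytic0; apply/funext => x; rewrite -invfM; congr (_^-1).
  by field.
apply: analytic0M; first exact: analytic0_const.
have half1 : `|2^-1 : R| < 1 by rewrite ger0_norm //; lra.
apply: (@analytic0_subst _ _ _ _ (fun=> 1) (fun y => (1 - y)^-1) 2^-1 eHs f0 B0).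
- move=> N; apply: le_trans qL; apply: le_trans (_ : q * series U N <= _); last first.
    by rewrite ler_wpM2l // ltW.
  rewrite /series /= mulr_sumr; apply: ler_sum => k _; rewrite /U exprMn.
  case: k => [|k]; first by rewrite B0 !mul0r mulr0.
  rewrite mulrCA ler_wpM2r ?U0 // exprS ler_piMr ?exprn_ile1 // ltW //.
- have := is_cvg_geometric_series (a := 1) half1.
  by congr (cvgn (series _)); apply/funext => j; rewrite normr1.
- move=> y y2; rewrite -[X in _ --> X]mul1r; apply: cvg_geometric_series.
  by apply: le_lt_trans y2 _; lra.
Qed.

End Expansions.

(** * Quaternions *)

Notation "p ** q" := (qmul p q) (at level 40, left associativity).

Section Quaternions.
Variable R : realType.
Implicit Types (p q u v : quat R) (a b c d : R).

Lemma qcoord_mk a b c d :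
  (qcoord (mkquat a b c d) 0 = a) * (qcoord (mkquat a b c d) 1 = b) *
  (qcoord (mkquat a b c d) 2 = c) * (qcoord (mkquat a b c d) 3 = d).
Proof. by rewrite /qcoord !mxE !inordK. Qed.

Lemma qcoordD p q k : qcoord (p + q) k = qcoord p k + qcoord q k.
Proof. by rewrite /qcoord mxE. Qed.

Lemma qcoordN p k : qcoord (- p) k = - qcoord p k.
Proof. by rewrite /qcoord mxE. Qed.

Lemma qcoordZ a p k : qcoord (a *: p) k = a * qcoord p k.
Proof. by rewrite /qcoord mxE. Qed.

Lemma qcoord0 k : qcoord (0 : quat R) k = 0.
Proof. by rewrite /qcoord mxE. Qed.

Lemma qcoord_inj p q : qcoord p 0 = qcoord q 0 -> qcoord p 1 = qcoord q 1 ->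
  qcoord p 2 = qcoord q 2 -> qcoord p 3 = qcoord q 3 -> p = q.
Proof.
move=> e0 e1 e2 e3; apply/rowP => j; rewrite -(inord_val j).
by case: j => -[|[|[|[|//]]]] ? /=.
Qed.

(** The real scalar product, its square norm and the inverse it gives. The latter
    two are kept free of square roots, unlike [qnorm]. *)
Definition qdot p q : R := qre (qconj p ** q).
Definition qsq p : R := qdot p p.
Definition qinv q : quat R := (qsq q)^-1 *: qconj q.

Definition qE := (qcoord_mk, qcoordD, qcoordN, qcoordZ, qcoord0).

End Quaternions.

Ltac qcoords := rewrite /qsq /qdot /qre /qmul /qconj /qone ?qE.
Ltac qring := (try apply: qcoord_inj); qcoords; ring.

Section QuaternionAlgebra.
Variable R : realType.
Implicit Types (p q r u v : quat R) (a b c d : R).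

Lemma qmulA p q r : p ** (q ** r) = p ** q ** r. Proof. qring. Qed.
Lemma qmulDl p q r : (p + q) ** r = p ** r + q ** r. Proof. qring. Qed.
Lemma qmulDr p q r : p ** (q + r) = p ** q + p ** r. Proof. qring. Qed.
Lemma qmulNl p q : (- p) ** q = - (p ** q). Proof. qring. Qed.
Lemma qmulNr p q : p ** (- q) = - (p ** q). Proof. qring. Qed.
Lemma qmulBl p q r : (p - q) ** r = p ** r - q ** r. Proof. qring. Qed.
Lemma qmulBr p q r : p ** (q - r) = p ** q - p ** r. Proof. qring. Qed.
Lemma qmulZl a p q : (a *: p) ** q = a *: (p ** q). Proof. qring. Qed.
Lemma qmulZr a p q : p ** (a *: q) = a *: (p ** q). Proof. qring. Qed.
Lemma qmul0l p : 0 ** p = 0. Proof. qring. Qed.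
Lemma qmul0r p : p ** 0 = 0. Proof. qring. Qed.
Lemma qmul1l p : qone R ** p = p. Proof. qring. Qed.
Lemma qmul1r p : p ** qone R = p. Proof. qring. Qed.
Lemma qconjD p q : qconj (p + q) = qconj p + qconj q. Proof. qring. Qed.
Lemma qconjN p : qconj (- p) = - qconj p. Proof. qring. Qed.
Lemma qconjB p q : qconj (p - q) = qconj p - qconj q. Proof. qring. Qed.
Lemma qconjZ a p : qconj (a *: p) = a *: qconj p. Proof. qring. Qed.
Lemma qconjM p q : qconj (p ** q) = qconj q ** qconj p. Proof. qring. Qed.
Lemma qconjK p : qconj (qconj p) = p. Proof. qring. Qed.
Lemma qconj0 : qconj (0 : quat R) = 0. Proof. qring. Qed.
Lemma qconj1 : qconj (qone R) = qone R. Proof. qring. Qed.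
Lemma qreD p q : qre (p + q) = qre p + qre q. Proof. qring. Qed.
Lemma qreN p : qre (- p) = - qre p. Proof. qring. Qed.
Lemma qreZ a p : qre (a *: p) = a * qre p. Proof. qring. Qed.
Lemma qre_conj p : qre (qconj p) = qre p. Proof. qring. Qed.
Lemma qre0 : qre (0 : quat R) = 0. Proof. qring. Qed.
Lemma qre1 : qre (qone R) = 1. Proof. qring. Qed.
Lemma qreC p q : qre (p ** q) = qre (q ** p). Proof. qring. Qed.
Lemma qsqE p : qsq p =
  qcoord p 0 ^+ 2 + qcoord p 1 ^+ 2 + qcoord p 2 ^+ 2 + qcoord p 3 ^+ 2.
Proof. qring. Qed.
Lemma qdotE p q : qdot p q = qcoord p 0 * qcoord q 0 + qcoord p 1 * qcoord q 1
  + qcoord p 2 * qcoord q 2 + qcoord p 3 * qcoord q 3.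
Proof. qring. Qed.
Lemma qmul_conjl p : qconj p ** p = qsq p *: qone R. Proof. qring. Qed.
Lemma qmul_conjr p : p ** qconj p = qsq p *: qone R. Proof. qring. Qed.
Lemma qsqZ a p : qsq (a *: p) = a ^+ 2 * qsq p. Proof. qring. Qed.
Lemma qsq_conj p : qsq (qconj p) = qsq p. Proof. qring. Qed.
Lemma qsqN p : qsq (- p) = qsq p. Proof. qring. Qed.
Lemma qsq1 : qsq (qone R) = 1. Proof. qring. Qed.

Lemma qsq_ge0 p : 0 <= qsq p.
Proof. by rewrite qsqE !addr_ge0 // sqr_ge0. Qed.

Lemma qsq_eq0 p : (qsq p == 0) = (p == 0).
Proof.
apply/eqP/eqP => [|->]; last by qring.
have := (sqr_ge0 (qcoord p 0), sqr_ge0 (qcoord p 1), sqr_ge0 (qcoord p 2), sqr_ge0 (qcoord p 3)).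
move=> [[[h0 h1] h2] h3]; rewrite qsqE => h.
by apply: qcoord_inj; rewrite qcoord0; apply/eqP; rewrite -sqrf_eq0; apply/eqP; lra.
Qed.

Lemma qsq_gt0 p : (0 < qsq p) = (p != 0).
Proof. by rewrite lt_def qsq_ge0 andbT qsq_eq0. Qed.

Lemma qnormE p : qnorm p = Num.sqrt (qsq p).
Proof.
rewrite /qnorm qsqE 3!big_ord_recl big_ord1 /qcoord !addrA; do 4!f_equal.
all: by do 3?f_equal; apply/val_inj; rewrite /= inordK.
Qed.

Lemma qmulVq q : q != 0 -> qinv q ** q = qone R.
Proof.
rewrite -qsq_gt0 => q0; rewrite /qinv qmulZl qmul_conjl scalerA mulVf ?scale1r //.
by rewrite gt_eqF.
Qed.

Lemma qmulqV q : q != 0 -> q ** qinv q = qone R.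
Proof.
rewrite -qsq_gt0 => q0; rewrite /qinv qmulZr qmul_conjr scalerA mulVf ?scale1r //.
by rewrite gt_eqF.
Qed.

Lemma qdotC p q : qdot p q = qdot q p. Proof. qring. Qed.
Lemma qdotDl p q r : qdot (p + q) r = qdot p r + qdot q r. Proof. qring. Qed.
Lemma qdotDr p q r : qdot p (q + r) = qdot p q + qdot p r. Proof. qring. Qed.
Lemma qdotNl p q : qdot (- p) q = - qdot p q. Proof. qring. Qed.
Lemma qdotNr p q : qdot p (- q) = - qdot p q. Proof. qring. Qed.
Lemma qdotZl a p q : qdot (a *: p) q = a * qdot p q. Proof. qring. Qed.
Lemma qdotZr a p q : qdot p (a *: q) = a * qdot p q. Proof. qring. Qed.
Lemma qdot_mull u p q : qdot (u ** p) q = qdot p (qconj u ** q).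
Proof. by rewrite /qdot qconjM qmulA. Qed.

Lemma qdot_mulr u p q : qdot (p ** u) q = qdot p (q ** qconj u).
Proof. by rewrite /qdot qconjM -qmulA qreC qmulA. Qed.

Lemma qdot_mul2r u p q : qdot (p ** u) (q ** u) = qsq u * qdot p q.
Proof. by rewrite qdot_mulr -qmulA qmul_conjr qmulZr qmul1r qdotZr. Qed.

Lemma qdot_mul2l u p q : qdot (u ** p) (u ** q) = qsq u * qdot p q.
Proof. by rewrite qdot_mull qmulA qmul_conjl qmulZl qmul1l qdotZr. Qed.

Lemma qsqM p q : qsq (p ** q) = qsq p * qsq q.
Proof. by rewrite {1}/qsq qdot_mul2r mulrC. Qed.

End QuaternionAlgebra.

(** * The Hermitian product of quaternionic vectors *)
Section HermitianProduct.
Variables (R : realType) (n : nat).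
Implicit Types (x y z : qvec R n) (p q : quat R) (a : R).

Definition qscale x q : qvec R n := mxvec (\matrix_(l, j) (qcomp x l ** q) 0 j).

Lemma qcomp_scale x q l : qcomp (qscale x q) l = qcomp x l ** q.
Proof. by rewrite /qcomp /qscale mxvecK; apply/rowP => j; rewrite !mxE. Qed.

Lemma qcompD x y l : qcomp (x + y) l = qcomp x l + qcomp y l.
Proof. by rewrite /qcomp !linearD. Qed.

Lemma qcompN x l : qcomp (- x) l = - qcomp x l.
Proof. by rewrite /qcomp !linearN. Qed.

Lemma qcompZ a x l : qcomp (a *: x) l = a *: qcomp x l.
Proof. by rewrite /qcomp !linearZ. Qed.

Lemma qcomp_inj x y : (forall l, qcomp x l = qcomp y l) -> x = y.
Proof.
move=> xy; apply: (can_inj vec_mxK); apply/row_matrixP => l; exact: xy.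
Qed.

Lemma qscaleDl x y q : qscale (x + y) q = qscale x q + qscale y q.
Proof. by apply: qcomp_inj => l; rewrite !(qcomp_scale, qcompD) qmulDl. Qed.

Lemma qscaleDr x p q : qscale x (p + q) = qscale x p + qscale x q.
Proof. by apply: qcomp_inj => l; rewrite !(qcomp_scale, qcompD) qmulDr. Qed.

Lemma qscaleNr x q : qscale x (- q) = - qscale x q.
Proof. by apply: qcomp_inj => l; rewrite !(qcomp_scale, qcompN) qmulNr. Qed.

Lemma qscaleZr a x q : qscale x (a *: q) = a *: qscale x q.
Proof. by apply: qcomp_inj => l; rewrite !(qcomp_scale, qcompZ) qmulZr. Qed.

Lemma qscale0l q : qscale 0 q = 0.
Proof.
by apply: qcomp_inj => l; rewrite qcomp_scale /qcomp !linear0 qmul0l.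
Qed.

Lemma qscaleA x p q : qscale (qscale x p) q = qscale x (p ** q).
Proof. by apply: qcomp_inj => l; rewrite !qcomp_scale qmulA. Qed.

Lemma qscale1 x : qscale x (qone R) = x.
Proof. by apply: qcomp_inj => l; rewrite qcomp_scale qmul1r. Qed.

Lemma hprodDl x y z : hprod (x + y) z = hprod x z + hprod y z.
Proof.
by rewrite /hprod -big_split; apply: eq_bigr => l _; rewrite qcompD qconjD qmulDl.
Qed.

Lemma hprodDr x y z : hprod x (y + z) = hprod x y + hprod x z.
Proof. by rewrite /hprod -big_split; apply: eq_bigr => l _; rewrite qcompD qmulDr. Qed.

Lemma hprodNl x y : hprod (- x) y = - hprod x y.
Proof.
by rewrite /hprod -sumrN; apply: eq_bigr => l _; rewrite qcompN qconjN qmulNl.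
Qed.

Lemma hprodNr x y : hprod x (- y) = - hprod x y.
Proof. by rewrite /hprod -sumrN; apply: eq_bigr => l _; rewrite qcompN qmulNr. Qed.

Lemma hprodZl a x y : hprod (a *: x) y = a *: hprod x y.
Proof.
by rewrite /hprod scaler_sumr; apply: eq_bigr => l _; rewrite qcompZ qconjZ qmulZl.
Qed.

Lemma hprodZr a x y : hprod x (a *: y) = a *: hprod x y.
Proof. by rewrite /hprod scaler_sumr; apply: eq_bigr => l _; rewrite qcompZ qmulZr. Qed.

Lemma hprod_scaler x y q : hprod x (qscale y q) = hprod x y ** q.
Proof.
rewrite /hprod (big_morph (fun p => p ** q) (fun p r => qmulDl p r q) (qmul0l q)).
by apply: eq_bigr => l _; rewrite qcomp_scale qmulA.
Qed.

Lemma hprod_conj x y : qconj (hprod x y) = hprod y x.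
Proof.
rewrite /hprod (big_morph (@qconj R) (@qconjD R) (@qconj0 R)).
by apply: eq_bigr => l _; rewrite qconjM qconjK.
Qed.

Lemma hprod_scalel x y q : hprod (qscale x q) y = qconj q ** hprod x y.
Proof. by rewrite -hprod_conj hprod_scaler qconjM hprod_conj. Qed.

Lemma sqnormE x : sqnorm x = \sum_(l < n) qsq (qcomp x l).
Proof.
by rewrite /sqnorm /hprod (big_morph (@qre R) (@qreD R) (qcoord0 R 0)).
Qed.

Lemma sqnorm_ge0 x : 0 <= sqnorm x.
Proof. by rewrite sqnormE sumr_ge0 // => l _; exact: qsq_ge0. Qed.

Lemma sqnorm_eq0 x : sqnorm x = 0 -> x = 0.
Proof.
rewrite sqnormE => /eqP; rewrite psumr_eq0 => [/allP h|l _]; last exact: qsq_ge0.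
apply: qcomp_inj => l; have := h l (mem_index_enum l).
by rewrite /= qsq_eq0 => /eqP ->; rewrite /qcomp !linear0.
Qed.

Lemma hprod_self x : hprod x x = sqnorm x *: qone R.
Proof.
rewrite sqnormE scaler_suml /hprod; apply: eq_bigr => l _; exact: qmul_conjl.
Qed.

Lemma sqnormD x y : sqnorm (x + y) = sqnorm x + sqnorm y + 2 * qre (hprod x y).
Proof.
rewrite /sqnorm hprodDl !hprodDr !qreD -(qre_conj (hprod y x)) hprod_conj; ring.
Qed.

Lemma sqnormN x : sqnorm (- x) = sqnorm x.
Proof. by rewrite /sqnorm hprodNl hprodNr opprK. Qed.

Lemma sqnorm_scale x q : sqnorm (qscale x q) = sqnorm x * qsq q.
Proof.
by rewrite !sqnormE mulr_suml; apply: eq_bigr => l _; rewrite qcomp_scale qsqM.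
Qed.

Lemma sqnormZ a x : sqnorm (a *: x) = a ^+ 2 * sqnorm x.
Proof. by rewrite /sqnorm hprodZl hprodZr !qreZ mulrA. Qed.

Lemma hprod_cauchy_schwarz x y : qsq (hprod x y) <= sqnorm x * sqnorm y.
Proof.
have [x0|x0] := eqVneq (sqnorm x) 0.
  rewrite (sqnorm_eq0 x0) -(scale0r (0 : qvec R n)) hprodZl scale0r.
  by rewrite (eqP (_ : qsq 0 == 0)) ?qsq_eq0 // mulr_ge0 ?sqnorm_ge0.
have xp : 0 < sqnorm x by rewrite lt_def x0 sqnorm_ge0.
have := sqnorm_ge0 (sqnorm x *: y - qscale x (hprod x y)).
rewrite sqnormD sqnormN sqnormZ sqnorm_scale hprodNr qreN hprodZl hprod_scaler qreZ.
rewrite -[in qre _]hprod_conj qmul_conjl qreZ.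
rewrite qre1.
move=> h; rewrite -(ler_pM2l xp); lra.
Qed.

End HermitianProduct.

(** * The indefinite Hermitian form *)

Definition hvec (R : realType) (n : nat) : Type := (qvec R n * quat R)%type.

(** The form of signature (n,1) on pairs (affine part, last coordinate). It
    is locked because its value is a difference, which rewriting with additivity
    rules would take apart. *)
HB.lock Definition herm (R : realType) (n : nat) (X Y : hvec R n) : quat R :=
  hprod X.1 Y.1 - qconj X.2 ** Y.2.

Section HermitianForm.
Variables (R : realType) (n : nat).
Implicit Types (x y z : qvec R n) (p q : quat R) (a : R).
Local Notation hvec := (hvec R n).
Implicit Types (X Y Z : hvec).

Lemma hermE X Y : herm X Y = hprod X.1 Y.1 - qconj X.2 ** Y.2.
Proof. by rewrite unlock. Qed.

Definition hsq X : R := qre (herm X X).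
Definition hscale X q : hvec := (qscale X.1 q, X.2 ** q).
Definition hadd X Y : hvec := (X.1 + Y.1, X.2 + Y.2).

Lemma haddA X Y Z : hadd (hadd X Y) Z = hadd X (hadd Y Z).
Proof. by rewrite /hadd /= !addrA. Qed.

Lemma hermDl X Y Z : herm (hadd X Y) Z = herm X Z + herm Y Z.
Proof. by rewrite !hermE /= hprodDl qconjD qmulDl opprD addrACA. Qed.

Lemma hermDr X Y Z : herm X (hadd Y Z) = herm X Y + herm X Z.
Proof. by rewrite !hermE /= hprodDr qmulDr opprD addrACA. Qed.

Lemma herm_scaler X Y q : herm X (hscale Y q) = herm X Y ** q.
Proof. by rewrite !hermE /= hprod_scaler qmulA -qmulNl -qmulDl. Qed.

Lemma herm_conj X Y : qconj (herm X Y) = herm Y X.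
Proof. by rewrite !hermE qconjB hprod_conj qconjM qconjK. Qed.

Lemma herm_scalel X Y q : herm (hscale X q) Y = qconj q ** herm X Y.
Proof. by rewrite -herm_conj herm_scaler qconjM herm_conj. Qed.

Lemma hscaleA X p q : hscale (hscale X p) q = hscale X (p ** q).
Proof. by rewrite /hscale /= qscaleA qmulA. Qed.

Lemma hscaleDl X Y q : hscale (hadd X Y) q = hadd (hscale X q) (hscale Y q).
Proof. by rewrite /hscale /hadd /= qscaleDl qmulDl. Qed.

Lemma hsqE X : hsq X = sqnorm X.1 - qsq X.2.
Proof. by rewrite /hsq hermE qreD qreN. Qed.

Lemma herm_self X : herm X X = hsq X *: qone R.
Proof. by rewrite hsqE hermE hprod_self qmul_conjl scalerBl. Qed.

Lemma herm_eq0 X Y : herm X Y = 0 -> hprod X.1 Y.1 = qconj X.2 ** Y.2.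
Proof. by rewrite hermE => /eqP; rewrite subr_eq0 => /eqP. Qed.

Lemma hsq_scale X q : hsq (hscale X q) = hsq X * qsq q.
Proof. by rewrite !hsqE /= sqnorm_scale qsqM mulrBl. Qed.

Lemma hsqD X Y : hsq (hadd X Y) = hsq X + hsq Y + 2 * qre (herm X Y).
Proof.
rewrite /hsq hermDl !hermDr !qreD -(herm_conj X Y) qre_conj; ring.
Qed.

(** A negative vector uses up the only negative direction of the form. In
    coordinates this is the Cauchy-Schwarz inequality for the affine parts. *)
Lemma hsq_orth_ge0 Z Y : hsq Z < 0 -> herm Z Y = 0 -> 0 <= hsq Y.
Proof.
rewrite !hsqE => Z0 /herm_eq0 ZY.
have := hprod_cauchy_schwarz Z.1 Y.1; rewrite ZY qsqM qsq_conj => h.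
have z0 := sqnorm_ge0 Z.1; have y0 := sqnorm_ge0 Y.1.
have Z2 : 0 < qsq Z.2 by lra.
rewrite subr_ge0 -(ler_pM2l Z2); apply: le_trans h _.
by apply: ler_wpM2r => //; lra.
Qed.

Lemma hsq_orth_eq0 Z Y : hsq Z < 0 -> herm Z Y = 0 -> hsq Y = 0 -> Y = (0, 0).
Proof.
rewrite !hsqE => Z0 /herm_eq0 ZY.
have := hprod_cauchy_schwarz Z.1 Y.1; rewrite ZY qsqM qsq_conj => h Y0.
have z0 := sqnorm_ge0 Z.1; have y0 := sqnorm_ge0 Y.1.
have yy : sqnorm Y.1 = 0 by nra.
have /eqP : qsq Y.2 = 0 by lra.
by rewrite qsq_eq0 => /eqP; move: (sqnorm_eq0 yy); case: (Y) => ? ? /= -> ->.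
Qed.

Lemma metricC x y z : metric x y z = metric x z y.
Proof.
rewrite /metric -(qre_conj (hprod y z)) hprod_conj; congr (4 * (_ + _) / _).
by rewrite -(qre_conj (qmul _ _)) qconjM qconjK.
Qed.

Lemma metric_linear x z a y w :
  metric x (a *: y + w) z = a * metric x y z + metric x w z.
Proof.
rewrite /metric !(hprodDl, hprodZl, qconjD, qconjZ, qmulDl, qmulZl, qreD, qreZ).
ring.
Qed.

Definition hlift x : hvec := (x, qone R).
Definition aff X : qvec R n := qscale X.1 (qinv X.2).

Lemma hsq_hlift x : hsq (hlift x) = sqnorm x - 1.
Proof. by rewrite hsqE /= qsq1. Qed.

Lemma qhyp_hlift x : qhyp x <-> hsq (hlift x) < 0.
Proof. by rewrite hsq_hlift /qhyp /=; split; lra. Qed.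

Lemma hsq_neg_neq0 X : hsq X < 0 -> X.2 != 0.
Proof. by rewrite hsqE -qsq_gt0 => h; have := sqnorm_ge0 X.1; lra. Qed.

Lemma hlift_aff X : X.2 != 0 -> hlift (aff X) = hscale X (qinv X.2).
Proof. by move=> X2; rewrite /hlift /aff /hscale qmulqV. Qed.

Lemma aff_hlift x : aff (hlift x) = x.
Proof.
rewrite /aff /= /qinv qsq1 invr1 scale1r qconj1; exact: qscale1.
Qed.

Lemma qinv_neq0 q : q != 0 -> qinv q != 0.
Proof.
move=> q0; apply/eqP => h; have := qmulVq q0; rewrite h qmul0l => /esym/eqP.
by rewrite -qsq_eq0 qsq1 oner_eq0.
Qed.

Lemma qinvM p q : p != 0 -> q != 0 -> qinv (p ** q) = qinv q ** qinv p.
Proof.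
move=> p0 q0; rewrite /qinv qsqM qconjM qmulZl qmulZr scalerA invfM mulrC.
by rewrite mulrC.
Qed.

Lemma aff_scale X q : X.2 != 0 -> q != 0 -> aff (hscale X q) = aff X.
Proof.
by move=> X2 q0; rewrite /aff /= qinvM // qscaleA qmulA qmulqV // qmul1l.
Qed.

Lemma qhyp_aff X : hsq X < 0 -> qhyp (aff X).
Proof.
move=> Xneg; have X2 := hsq_neg_neq0 Xneg.
apply/qhyp_hlift; rewrite hlift_aff // hsq_scale pmulr_llt0 //.
by rewrite qsq_gt0 qinv_neq0.
Qed.

End HermitianForm.

(** * Differential calculus *)
Section LinearForms.
Variables (R : realType) (N : nat) (f : 'rV[R]_N -> R).
Hypothesis flin : linear_for *%R f.

Lemma linear_for0 : f 0 = 0.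
Proof. by have := flin (-1) 0 0; rewrite scaler0 add0r mulN1r addNr. Qed.

Lemma linear_forD x y : f (x + y) = f x + f y.
Proof. by have := flin 1 x y; rewrite scale1r mul1r. Qed.

Lemma linear_forZ a x : f (a *: x) = a * f x.
Proof. by have := flin a x 0; rewrite linear_for0 !addr0. Qed.

Lemma linear_for_sum (I : finType) (c : I -> R) (e : I -> 'rV[R]_N) :
  f (\sum_i c i *: e i) = \sum_i c i * f (e i).
Proof.
apply: (big_ind2 (fun x y => f x = y)) => [|x1 x2 y1 y2 h1 h2|i _].
- exact: linear_for0.
- by rewrite linear_forD h1 h2.
- exact: linear_forZ.
Qed.

Lemma linear_forE x : f x = \sum_(i < N) x 0 i * f (delta_mx 0 i).
Proof. by rewrite {1}[x]row_sum_delta linear_for_sum. Qed.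

End LinearForms.

Section Differentials.
Variables (R : realType) (N : nat).
Local Notation V := 'rV[R]_N.
Implicit Types (p u : V).

(** The differential is prescribed pointwise, so that it can be adjusted by
    pointwise computation ([has_diff_eq]). *)
Definition has_diff (W : normedModType R) (f : V -> W) p (df : V -> W) : Prop :=
  differentiable f p /\ forall u, 'd f p u = df u.

Lemma has_diff_isP (W : normedModType R) (f : V -> W) p (df : V -> W) :
  has_diff f p df <-> is_diff p f df.
Proof.
split=> [[f1 f2]|[f1 f2]]; last by split=> // u; rewrite f2.
by split=> //; apply/funext => u; rewrite f2.
Qed.

Lemma has_diff_eq (W : normedModType R) (f : V -> W) p (df dg : V -> W) :
  has_diff f p df -> (forall u, df u = dg u) -> has_diff f p dg.
Proof. by move=> [f1 f2] e; split=> // u; rewrite f2. Qed.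

Lemma has_diff_derive (W : normedModType R) (f : V -> W) p (df : V -> W) u :
  has_diff f p df -> 'D_u f p = df u.
Proof. by move=> [f1 f2]; rewrite deriveE. Qed.

Lemma has_diff_cst (W : normedModType R) (c : W) p : has_diff (fun=> c) p (fun=> 0).
Proof. by apply/has_diff_isP; exact: (is_diff_cst c p). Qed.

Lemma has_diff_id p : has_diff id p id.
Proof. by apply/has_diff_isP; exact: is_diff_id. Qed.

Lemma has_diffD (W : normedModType R) (f g df dg : V -> W) p :
  has_diff f p df -> has_diff g p dg ->
  has_diff (fun x => f x + g x) p (fun u => df u + dg u).
Proof.
by move=> /has_diff_isP hf /has_diff_isP hg; apply/has_diff_isP; exact: is_diffD.
Qed.

Lemma has_diffN (W : normedModType R) (f df : V -> W) p :
  has_diff f p df -> has_diff (fun x => - f x) p (fun u => - df u).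
Proof. by move=> /has_diff_isP hf; apply/has_diff_isP; exact: is_diffN. Qed.

Lemma has_diff_sum (W : normedModType R) (I : Type) (s : seq I) (f df : I -> V -> W) p :
  (forall i, has_diff (f i) p (df i)) ->
  has_diff (fun x => \sum_(i <- s) f i x) p (fun u => \sum_(i <- s) df i u).
Proof.
move=> h; elim: s => [|i s IH].
  rewrite (_ : (fun x => _) = fun=> 0); last by apply/funext => x; rewrite big_nil.
  by apply: has_diff_eq (has_diff_cst _ _) _ => u; rewrite big_nil.
rewrite (_ : (fun x => _) = fun x => f i x + \sum_(j <- s) f j x).
  by apply: has_diff_eq (has_diffD (h i) IH) _ => u; rewrite big_cons.
by apply/funext => x; rewrite big_cons.
Qed.

Lemma has_diffM (f g df dg : V -> R) p :
  has_diff f p df -> has_diff g p dg ->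
  has_diff (fun x => f x * g x) p (fun u => df u * g p + f p * dg u).
Proof.
move=> /has_diff_isP hf /has_diff_isP hg; apply: (@has_diff_eq _ _ _ (f p *: dg + g p *: df)).
  by apply/has_diff_isP; exact: is_diffM.
by move=> u; rewrite addrC [df u * _]mulrC.
Qed.

Lemma has_diff_comp (f df : V -> R) (g : R -> R) (g' : R) p :
  has_diff f p df -> is_derive (f p) 1 g g' ->
  has_diff (fun x => g (f x)) p (fun u => g' * df u).
Proof.
move=> [f1 f2] hg; have g1 : differentiable g (f p) by apply/derivable1_diffP; exact: ex_derive.
split; first exact: differentiable_comp.
move=> u; rewrite (diff_comp f1 g1) /= f2.
have -> : 'd g (f p) (df u) = df u *: 'd g (f p) 1.
  by rewrite -linearZ /= /GRing.scale /= mulr1.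
by rewrite -deriveE // derive_val mulrC.
Qed.

Lemma has_diffV (f df : V -> R) p : f p != 0 -> has_diff f p df ->
  has_diff (fun x => (f x)^-1) p (fun u => - (f p) ^- 2 * df u).
Proof.
move=> f0 [f1 f2]; split; first exact: differentiableV.
by move=> u; rewrite diffV //= f2.
Qed.

Lemma has_diff_coord k (f df : V -> 'rV[R]_k) p j :
  has_diff f p df -> has_diff (fun x => f x 0 j) p (fun u => df u 0 j).
Proof.
move=> [f1 f2]; pose c : 'rV[R]_k -> R := fun M => M 0 j.
have clin : linear c by move=> a x y; rewrite /c !mxE.
pose cL := GRing.isLinear.Build _ _ _ _ c clin.
pose C : {linear 'rV[R]_k -> R} := HB.pack c cL.
have cont : continuous C by exact: coord_continuous.
have h := diff_comp f1 (linear_differentiable (f p) cont).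
split; first exact: (differentiable_comp f1 (linear_differentiable (f p) cont)).
move=> u; apply: (etrans (congr1 (fun g => g u) h)).
apply: (etrans (congr1 (fun g => g ('d f p u)) (diff_lin (f p) cont))).
by rewrite f2.
Qed.

Lemma has_diff_rV k (f df : V -> 'rV[R]_k) p :
  (forall j, has_diff (fun x => f x 0 j) p (fun u => df u 0 j)) -> has_diff f p df.
Proof.
move=> h; have fd : differentiable f p.
  rewrite (_ : f = \sum_(j < k) (fun x => f x 0 j *: delta_mx 0 j)).
    by apply: differentiable_sum => j; apply: differentiableZl; have [] := h j.
  by apply/funext => x; rewrite fct_sumE {1}[f x]row_sum_delta.
split=> // u; apply/rowP => j; have [_ <-] := h j.
have hf : has_diff f p ('d f p) by split.
by have [_ ->] := has_diff_coord j hf.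
Qed.

Lemma has_diff_linear (f : V -> R) p : linear_for *%R f -> has_diff f p f.
Proof.
move=> flin.
rewrite (_ : f = fun x => \sum_(i < N) f (delta_mx 0 i) * x 0 i); last first.
  by apply/funext => x; rewrite (linear_forE flin); apply: eq_bigr => i _; rewrite mulrC.
apply: has_diff_sum => i.
apply: (@has_diff_eq _ _ _ (fun u => 0 * p 0 i + f (delta_mx 0 i) * u 0 i)).
  apply: (has_diffM (f := fun=> f (delta_mx 0 i)) (g := fun x => x 0 i)).
    exact: has_diff_cst.
  exact: (has_diff_coord i (has_diff_id p)).
by move=> u; rewrite mul0r add0r.
Qed.

End Differentials.

Section QuaternionDifferentials.
Variables (R : realType) (N n : nat).
Local Notation V := 'rV[R]_N.
Implicit Types (p u : V).

Lemma has_diff_quat (f df : V -> quat R) p :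
  (forall k, (k < 4)%N ->
    has_diff (fun x => qcoord (f x) k) p (fun u => qcoord (df u) k)) ->
  has_diff f p df.
Proof.
move=> h; apply: has_diff_rV => j.
by have := h j (ltn_ord j); rewrite /qcoord inord_val.
Qed.

Lemma has_diff_qcoord (f df : V -> quat R) p k : has_diff f p df ->
  has_diff (fun x => qcoord (f x) k) p (fun u => qcoord (df u) k).
Proof. exact: has_diff_coord. Qed.

Lemma has_diff_qmul (f g df dg : V -> quat R) p :
  has_diff f p df -> has_diff g p dg ->
  has_diff (fun x => f x ** g x) p (fun u => df u ** g p + f p ** dg u).
Proof.
move=> hf hg.
have hM i j := has_diffM (has_diff_qcoord i hf) (has_diff_qcoord j hg).
apply: has_diff_quat => -[|[|[|[|//]]]] _; rewrite /qmul /=.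
all: under eq_fun do rewrite !qE.
all: apply: has_diff_eq; first by
  repeat (exact: hM || apply: has_diffD || apply: has_diffN).
all: by move=> u; rewrite !qE; ring.
Qed.

Lemma has_diff_qconj (f df : V -> quat R) p : has_diff f p df ->
  has_diff (fun x => qconj (f x)) p (fun u => qconj (df u)).
Proof.
move=> hf; have h k := has_diff_qcoord k hf.
apply: has_diff_quat => -[|[|[|[|//]]]] _; rewrite /qconj /=.
all: under eq_fun do rewrite !qE.
all: apply: has_diff_eq; first by repeat (exact: h || apply: has_diffN).
all: by move=> u; rewrite !qE.
Qed.

Lemma has_diffZ (k : nat) (a da : V -> R) (f df : V -> 'rV[R]_k) p :
  has_diff a p da -> has_diff f p df ->
  has_diff (fun x => a x *: f x) p (fun u => da u *: f p + a p *: df u).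
Proof.
move=> ha hf; apply: has_diff_rV => j.
rewrite (_ : (fun x => _) = fun x => a x * f x 0 j); last first.
  by apply/funext => x; rewrite mxE.
by apply: has_diff_eq (has_diffM ha (has_diff_coord j hf)) _ => u; rewrite !mxE.
Qed.

Lemma has_diff_qsq (f df : V -> quat R) p : has_diff f p df ->
  has_diff (fun x => qsq (f x)) p (fun u => 2 * qdot (f p) (df u)).
Proof.
move=> hf; have h := has_diff_qcoord 0 (has_diff_qmul (has_diff_qconj hf) hf).
apply: has_diff_eq h _ => u.
by rewrite -/(qre (_ + _)) qreD -!/(qdot _ _) (qdotC (df u)); ring.
Qed.

Lemma has_diff_qinv (f df : V -> quat R) p : f p != 0 -> has_diff f p df ->
  has_diff (fun x => qinv (f x)) p (fun u => - (qinv (f p) ** df u ** qinv (f p))).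
Proof.
move=> f0 hf; have N0 : qsq (f p) != 0 by rewrite qsq_eq0.
have hV := @has_diffV _ _ (fun x => qsq (f x)) _ p N0 (has_diff_qsq hf).
apply: has_diff_eq (has_diffZ hV (has_diff_qconj hf)) _.
move=> u; rewrite /qinv !(qmulZl, qmulZr) scalerA.
set q := f p in N0 *; set r := df u.
have -> : qconj q ** r ** qconj q = (2 * qdot q r) *: qconj q - qsq q *: qconj r by qring.
rewrite scalerBr opprB !scalerA addrC -scaleNr; congr (_ *: _ + _ *: _).
  by field.
by field.
Qed.

Lemma has_diff_qcomp (f df : V -> qvec R n) p l : has_diff f p df ->
  has_diff (fun x => qcomp (f x) l) p (fun u => qcomp (df u) l).
Proof.
move=> hf; apply: has_diff_rV => j; have := has_diff_coord (mxvec_index l j) hf.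
by rewrite /qcomp; congr has_diff; apply/funext => x; rewrite !mxE.
Qed.

Lemma has_diff_qvec (f df : V -> qvec R n) p :
  (forall l, has_diff (fun x => qcomp (f x) l) p (fun u => qcomp (df u) l)) ->
  has_diff f p df.
Proof.
move=> h; apply: has_diff_rV => j; case/mxvec_indexP: j => l k.
have := has_diff_coord k (h l).
by rewrite /qcomp; congr has_diff; apply/funext => x; rewrite !mxE.
Qed.

Lemma has_diff_qscale (f df : V -> qvec R n) (q dq : V -> quat R) p :
  has_diff f p df -> has_diff q p dq ->
  has_diff (fun x => qscale (f x) (q x)) p (fun u => qscale (df u) (q p) + qscale (f p) (dq u)).
Proof.
move=> hf hq; apply: has_diff_qvec => l.
rewrite (_ : (fun x => _) = fun x => qcomp (f x) l ** q x); last first.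
  by apply/funext => x; rewrite qcomp_scale.
apply: has_diff_eq (has_diff_qmul (has_diff_qcomp l hf) hq) _ => u.
by rewrite qcompD !qcomp_scale.
Qed.

End QuaternionDifferentials.

(** * Derivatives of the metric *)
Section FormDifferentials.
Variables (R : realType) (n : nat).
Implicit Types (x u w p : qvec R n).

Lemma has_diff_hprodr a p : has_diff (fun x => hprod a x) p (fun u => hprod a u).
Proof.
apply: has_diff_quat => k _; apply: has_diff_linear => c x y.
by rewrite hprodDr hprodZr qcoordD qcoordZ.
Qed.

Lemma has_diff_hprodl a p : has_diff (fun x => hprod x a) p (fun u => hprod u a).
Proof.
apply: has_diff_quat => k _; apply: has_diff_linear => c x y.
by rewrite hprodDl hprodZl qcoordD qcoordZ.
Qed.

Lemma has_diff_sqnorm p : has_diff (@sqnorm R n) p (fun u => 2 * qre (hprod p u)).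
Proof.
rewrite (_ : @sqnorm R n = fun x => \sum_(l < n) qsq (qcomp x l)); last first.
  by apply/funext => x; exact: sqnormE.
apply: has_diff_eq (has_diff_sum _ _) _.
  by move=> l; apply: has_diff_qsq; apply: has_diff_qcomp; exact: has_diff_id.
move=> u; rewrite -mulr_sumr; congr (2 * _).
by rewrite /hprod (big_morph (@qre R) (@qreD R) (@qre0 R)).
Qed.

(** Derivative of the metric coefficient [g(u,u)] in the direction [w]. *)
Definition dmetric x u w : R :=
  4 * (2 * qdot (hprod x u) (hprod w u) - 2 * qre (hprod x w) * sqnorm u)
    / (1 - sqnorm x) ^+ 2
  + 16 * qre (hprod x w) * ((1 - sqnorm x) * sqnorm u + qsq (hprod x u))
    / (1 - sqnorm x) ^+ 3.

Lemma metric_diag x u : metric x u u =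
  4 * ((1 - sqnorm x) * sqnorm u + qsq (hprod x u)) / (1 - sqnorm x) ^+ 2.
Proof. by rewrite /metric -/(qdot _ _) -/(qsq _) -qsq_conj hprod_conj. Qed.

Lemma derive_metric p u w : qhyp p ->
  'D_w (fun x => metric x u u) p = dmetric p u w.
Proof.
move=> pB; have D0 : 1 - sqnorm p != 0 by rewrite gt_eqF // subr_gt0.
have hD := has_diffD (has_diff_cst (1 : R) p) (has_diffN (has_diff_sqnorm p)).
have hA := has_diffD (has_diffM hD (has_diff_cst (sqnorm u) p))
  (has_diff_qsq (has_diff_hprodl u p)).
have D20 : (1 - sqnorm p) * (1 - sqnorm p) != 0 by rewrite mulf_neq0.
have hV := @has_diffV _ _ (fun x => (1 - sqnorm x) * (1 - sqnorm x)) _ p D20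
  (has_diffM hD hD).
have h := has_diffM (has_diffM (has_diff_cst (4 : R) p) hA) hV.
under eq_fun do rewrite metric_diag expr2.
by rewrite (has_diff_derive w h) /dmetric; field.
Qed.

(** The two derivatives of [g] that are not along [w] cancel on the diagonal, so
    that the trace of the second fundamental form involves [dmetric] only. *)
Lemma christoffel_diag p u w :
  christoffel p u w u = 2^-1 * 'D_w (fun x => metric x u u) p.
Proof.
rewrite /christoffel; congr (_ * _).
rewrite (_ : (fun x => metric x w u) = fun x => metric x u w); first by rewrite addrAC subrr add0r.
by apply/funext => x; exact: metricC.
Qed.

End FormDifferentials.

(** * The helicoids in the half-space coordinate *)
Section Helicoid.
Variable R : realType.

Definition helicoid_fun (t : R) (y : quat R) : R :=
  qcoord y 2 * cos (t * qcoord y 1) - qcoord y 3 * sin (t * qcoord y 1).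

Definition helicoid_grad (t : R) (y : quat R) : quat R :=
  mkquat 0 (- t * (qcoord y 2 * sin (t * qcoord y 1) + qcoord y 3 * cos (t * qcoord y 1)))
    (cos (t * qcoord y 1)) (- sin (t * qcoord y 1)).

(** The Hessian, with its entry on [i] written through
    [helicoid_fun], which vanishes on the surface. *)
Definition helicoid_hess (t : R) (y z : quat R) : quat R :=
  mkquat 0
    (- t * (qcoord z 2 * sin (t * qcoord y 1) + qcoord z 3 * cos (t * qcoord y 1)
            + t * qcoord z 1 * helicoid_fun t y))
    (- sin (t * qcoord y 1) * (t * qcoord z 1))
    (- cos (t * qcoord y 1) * (t * qcoord z 1)).

Definition qbasis (j : nat) : quat R :=
  mkquat (j == 0)%:R (j == 1)%:R (j == 2)%:R (j == 3)%:R.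

Lemma qdot_qbasis j q : (j < 4)%N -> qdot (qbasis j) q = qcoord q j.
Proof.
by rewrite qdotE /qbasis !qE; case: j => [|[|[|[|//]]]] _ /=; rewrite !(mul0r, mul1r, addr0, add0r).
Qed.

(** This is the minimality of the helicoid. On its zero locus [helicoid_fun t] has
    vanishing Laplacian, and its Hessian vanishes on the gradient [v]; the second
    summand of [psi] comes from the hyperbolic metric and contributes nothing as
    [v] has no real part. *)
Lemma helicoid_trace0 t s y : helicoid_fun t y = 0 ->
  let v := helicoid_grad t y in let psi c := helicoid_hess t y (s *: c) + v ** (c - qconj c) in
  qcoord (psi (qbasis 0)) 0 + qcoord (psi (qbasis 1)) 1 + qcoord (psi (qbasis 2)) 2
    + qcoord (psi (qbasis 3)) 3 = 0 /\ qdot v (psi v) = 0.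
Proof.
move=> f0 v psi; rewrite /psi /v /helicoid_hess f0 /helicoid_grad /qbasis; split.
  by rewrite /qmul /qconj !qE /=; ring.
by rewrite qdotE /qmul /qconj !qE; ring.
Qed.

(** Conjugation by this unit quaternion rotates the plane of the last two
    coordinates by minus [t y_1], and thus carries the line [y_2 = 0] of that
    plane to the ruling of the helicoid at height [y_1]. *)
Definition spin t y : quat R :=
  mkquat (cos (t * qcoord y 1 / 2)) (- sin (t * qcoord y 1 / 2)) 0 0.

Lemma qsq_spin t y : qsq (spin t y) = 1.
Proof. by rewrite qsqE /spin !qE sqrrN cos2Dsin2 expr0n !addr0. Qed.

Lemma cos_sin_half (a : R) : (cos a = cos (a / 2) ^+ 2 - sin (a / 2) ^+ 2) *
  (sin a = 2 * (cos (a / 2) * sin (a / 2))).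
Proof. by rewrite {1 4}(splitr a) cosD sinD; split; ring. Qed.

Lemma spin_coord1 t y q : qcoord q 1 = qcoord y 1 -> spin t q = spin t y.
Proof. by rewrite /spin => ->. Qed.

Lemma qcoord1_conj_spin t y q : qcoord (qconj (spin t y) ** q ** spin t y) 1 = qcoord q 1.
Proof.
have := cos2Dsin2 (t * qcoord y 1 / 2); rewrite /spin /qconj /qmul !qE.
set c := cos _; set s := sin _ => cs.
by rewrite -[RHS]mul1r -cs; ring.
Qed.

Lemma spin_untwist t y : spin t (qconj (spin t y) ** y ** spin t y) = spin t y.
Proof. by apply: spin_coord1; exact: qcoord1_conj_spin. Qed.

Lemma helicoid_fun_untwist t y : helicoid_fun t y = 0 ->
  qcoord (qconj (spin t y) ** y ** spin t y) 2 = 0.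
Proof.
rewrite /helicoid_fun !(cos_sin_half (t * _)) => <-; rewrite /spin /qconj /qmul !qE; ring.
Qed.

Lemma helicoid_fun_twist t y :
  helicoid_fun t (spin t y ** (y - qcoord y 2 *: qbasis 2) ** qconj (spin t y)) = 0.
Proof.
set z := (_ ** _ ** _).
have z1 : qcoord z 1 = qcoord y 1.
  have := cos2Dsin2 (t * qcoord y 1 / 2); rewrite /z /spin /qconj /qmul /qbasis !qE /=.
  set c := cos _; set s := sin _ => cs.
  by rewrite -[RHS]mul1r -cs; ring.
rewrite /helicoid_fun z1 !(cos_sin_half (t * _)) /z /spin /qconj /qmul /qbasis !qE /=; ring.
Qed.

Variables (N : nat) (p : 'rV[R]_N) (f df : 'rV[R]_N -> quat R).
Hypothesis hf : has_diff f p df.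

Let hangle t : has_diff (fun x => t * qcoord (f x) 1) p (fun u => t * qcoord (df u) 1).
Proof.
apply: has_diff_eq (has_diffM (has_diff_cst t p) (has_diff_qcoord 1 hf)) _.
by move=> u; rewrite mul0r add0r.
Qed.

Let hcos t : has_diff (fun x => cos (t * qcoord (f x) 1)) p
  (fun u => - sin (t * qcoord (f p) 1) * (t * qcoord (df u) 1)).
Proof. exact: (has_diff_comp (hangle t) (is_derive_cos _)). Qed.

Let hsin t : has_diff (fun x => sin (t * qcoord (f x) 1)) p
  (fun u => cos (t * qcoord (f p) 1) * (t * qcoord (df u) 1)).
Proof. exact: (has_diff_comp (hangle t) (is_derive_sin _)). Qed.

Lemma has_diff_helicoid_fun t : has_diff (fun x => helicoid_fun t (f x)) p
  (fun u => qdot (helicoid_grad t (f p)) (df u)).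
Proof.
have := has_diffD (has_diffM (has_diff_qcoord 2 hf) (hcos t))
  (has_diffN (has_diffM (has_diff_qcoord 3 hf) (hsin t))).
by move/has_diff_eq; apply => u; rewrite qdotE /helicoid_grad !qE; ring.
Qed.

Lemma has_diff_helicoid_grad t : has_diff (fun x => helicoid_grad t (f x)) p
  (fun u => helicoid_hess t (f p) (df u)).
Proof.
apply: has_diff_quat => -[|[|[|[|//]]]] _; rewrite /helicoid_grad /helicoid_hess.
all: under eq_fun do rewrite qE.
- by apply: has_diff_eq (has_diff_cst _ _) _ => u; rewrite qE.
- have := has_diffM (has_diff_cst (- t) p)
    (has_diffD (has_diffM (has_diff_qcoord 2 hf) (hsin t))
               (has_diffM (has_diff_qcoord 3 hf) (hcos t))).
  by move/has_diff_eq; apply => u; rewrite !qE /helicoid_fun; ring.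
- by apply: has_diff_eq (hcos t) _ => u; rewrite qE.
- by apply: has_diff_eq (has_diffN (hsin t)) _ => u; rewrite qE mulNr.
Qed.

Lemma has_diff_spin t : exists df', has_diff (fun x => spin t (f x)) p df'.
Proof.
have hhalf : has_diff (fun x => t * qcoord (f x) 1 / 2) p (fun u => t * qcoord (df u) 1 / 2).
  have h := has_diffM (hangle t) (has_diff_cst (2^-1 : R) p).
  by apply: has_diff_eq h _ => u; rewrite mulr0 addr0.
have hc := has_diff_comp hhalf (is_derive_cos _).
have hs := has_diff_comp hhalf (is_derive_sin _).
exists (fun u => mkquat (- sin (t * qcoord (f p) 1 / 2) * (t * qcoord (df u) 1 / 2))
  (- (cos (t * qcoord (f p) 1 / 2) * (t * qcoord (df u) 1 / 2))) 0 0).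
apply: has_diff_quat => -[|[|[|[|//]]]] _; rewrite /spin.
all: under eq_fun do rewrite qE.
- by apply: has_diff_eq hc _ => u; rewrite qE.
- by apply: has_diff_eq (has_diffN hs) _ => u; rewrite qE.
- by apply: has_diff_eq (has_diff_cst _ _) _ => u; rewrite qE.
- by apply: has_diff_eq (has_diff_cst _ _) _ => u; rewrite qE.
Qed.

End Helicoid.

(** * Horizontal vector fields *)
Section HorizontalVectors.
Variables (R : realType) (n : nat).
Implicit Types (x u : qvec R n) (G Gd : hvec R n).

Lemma hprod_hlift_orth x G : herm (hlift x) G = 0 -> hprod x G.1 = G.2.
Proof. by move=> /herm_eq0 ->; rewrite /= qconj1 qmul1l. Qed.

Lemma hprod_affine_orth x G : herm (hlift x) G = 0 ->
  hprod x (G.1 - qscale x G.2) = (1 - sqnorm x) *: G.2.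
Proof.
move=> /hprod_hlift_orth xG; rewrite hprodDr hprodNr hprod_scaler xG hprod_self.
by rewrite qmulZl qmul1l scalerBl scale1r.
Qed.

(** A vector [G] orthogonal to the lift of [x] represents the tangent vector
    [G.1 - x G.2] in the affine chart. *)
Lemma metric_horizontal x G u : qhyp x -> herm (hlift x) G = 0 ->
  metric x (G.1 - qscale x G.2) u = 4 / (1 - sqnorm x) * qre (hprod G.1 u).
Proof.
move=> xB xG; have D0 : 1 - sqnorm x != 0 by rewrite gt_eqF // subr_gt0.
rewrite /metric hprod_conj (hprod_affine_orth xG) hprodDl hprodNl hprod_scalel.
rewrite qmulZl qreD qreN qreZ.
have -> : qre (qconj G.2 ** hprod x u) = qre (G.2 ** hprod u x).
  by rewrite -(hprod_conj x u) -(qre_conj (_ ** _)) qconjM qconjK qreC.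
by field.
Qed.

(** When [Gd] is the derivative along [u] of a lift [G] orthogonal to the point,
    the left-hand side is the covariant derivative of the corresponding affine
    field, paired with [u]. The terms in [G.2] cancel between the derivative of the
    field and that of the metric. *)
Lemma covariant_horizontal x u G Gd : qhyp x -> herm (hlift x) G = 0 ->
  metric x (Gd.1 - qscale u G.2 - qscale x Gd.2) u
    + 2^-1 * dmetric x u (G.1 - qscale x G.2)
  = 4 / (1 - sqnorm x) ^+ 2 *
    ((1 - sqnorm x) * qre (hprod Gd.1 u) + qre (herm (hlift x) Gd ** hprod u x)
     + qre (hprod x u ** hprod u G.1)).
Proof.
move=> xB xG; have D0 : 1 - sqnorm x != 0 by rewrite gt_eqF // subr_gt0.
have xW := hprod_affine_orth xG.
rewrite /metric /dmetric xW hprod_conj hermE /= qconj1 qmul1l.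
rewrite -(hprod_conj u (G.1 - _)) !(hprodDl, hprodNl, hprodDr, hprodNr).
rewrite !(hprod_scalel, hprod_scaler) !hprod_self -(hprod_conj x u).
move: (hprod x u) (hprod u G.1) (hprod Gd.1 u) (hprod x Gd.1) (G.2) (Gd.2).
move=> h e a b g gd; move: (sqnorm u) (sqnorm x) D0 => s X D0.
by qcoords; field.
Qed.

End HorizontalVectors.

(** The algebra of [nabla_hor_field]. There [m] and [y] are the coordinates [coF]
    and [halfsp] of the point, [mu] and [z] their derivatives along [u], [v] is
    the field and [w] its derivative, [h] is the product of the point with [u],
    and [D] is [1 - |x|^2]. Eliminating [m ** h] in favour of [M] and moving
    factors across the scalar product makes all terms without [z] cancel. *)
Lemma nabla_algebra (R : realType) (m y mu z v w h : quat R) (D : R) :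
  let ld := z ** m + y ** mu in
  let al := v ** m in let ga := - (qconj y ** v ** m) in
  let ald := w ** m + v ** mu in
  let gad := - (qconj z ** v ** m + qconj y ** w ** m + qconj y ** v ** mu) in
  let M := D *: mu + m ** h in
  D * (qdot ald ld + qdot gad mu)
    + qre ((qconj (y ** m) ** ald + qconj m ** gad) ** qconj h)
    + qre (h ** qconj (qconj al ** ld + qconj ga ** mu))
  = qdot ((D * qsq m) *: w + v ** M ** qconj m - v ** m ** qconj M) z.
Proof.
move=> ld al ga ald gad M.
have T2 a b : qre (qconj a ** b ** qconj h) = qdot (a ** h) b.
  by rewrite qreC /qdot qconjM qmulA.
have T3 a b : qre (h ** qconj (qconj a ** b)) = qdot b (a ** h).
  by rewrite qreC /qdot qconjM qconjK qmulA.
rewrite qmulDl qreD !T2 qconjD qmulDr qreD !T3.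
have hM : m ** h = M - D *: mu by rewrite /M addrC addKr.
have adj a b : qdot (qconj a ** b) M = qdot b (a ** M).
  by rewrite qdot_mull qconjK.
have -> : y ** m ** h = y ** M - D *: (y ** mu) by rewrite -qmulA hM qmulBr qmulZr.
have -> : qdot (m ** h) gad = qdot M gad - D * qdot mu gad by rewrite hM qdotDl qdotNl qdotZl.
have -> : qdot (y ** M - D *: (y ** mu)) ald = qdot ald (y ** M) - D * qdot ald (y ** mu).
  by rewrite qdotC qdotDr qdotNr qdotZr.
have -> : qdot ld (al ** h) = qdot (z ** m) (v ** m ** h) + qdot (y ** mu) (v ** m ** h).
  by rewrite qdotDl.
have -> : qdot mu (ga ** h) = - qdot (y ** mu) (v ** m ** h).
  by rewrite /ga qmulNl qdotNr -!qmulA [RHS]/(- _) (qdot_mull y).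
have -> : qdot ald ld = qdot ald (z ** m) + qdot ald (y ** mu) by rewrite qdotDr.
have -> : qdot ald (y ** M) = qdot (qconj y ** w ** m + qconj y ** v ** mu) M.
  by rewrite -!qmulA -qmulDr adj.
have -> : qdot M gad =
    - qdot (v ** m) (z ** M) - qdot (qconj y ** w ** m + qconj y ** v ** mu) M.
  rewrite (qdotC M) /gad qdotNl -[X in qdot X M]addrA (qdotDl (qconj z ** v ** m)).
  by rewrite -(qmulA (qconj z) v m) (adj z) opprD.
have -> : qdot ((D * qsq m) *: w + v ** M ** qconj m - v ** m ** qconj M) z =
  D * (qsq m * qdot w z) + qdot (v ** M) (z ** m) - qdot (v ** m) (z ** M).
  by rewrite qdotDl qdotNl qdotDl qdotZl !qdot_mulr !qconjK mulrA.
have -> : v ** M = D *: (v ** mu) + v ** m ** h.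
  by rewrite /M qmulDr qmulZr qmulA.
rewrite (qdotDl (D *: _)) qdotZl -(qdot_mul2r m w z) /ald (qdotDl _ _ (z ** m)).
rewrite (qdotC (v ** m ** h)) (qdotC mu gad); ring.
Qed.

(** * Parseval's identity *)
Section OrthonormalExpansion.
Variables (R : realType) (N : nat) (g : 'rV[R]_N -> 'rV[R]_N -> R).
Hypothesis g_lin : forall w, linear_for *%R (g^~ w).

Lemma orthonormal_basis (e : 'I_N -> 'rV[R]_N) :
  (forall i j, g (e i) (e j) = (i == j)%:R) ->
  forall w, w = \sum_i g w (e i) *: e i.
Proof.
move=> ee w; pose A := \matrix_i e i.
have coef (c : 'rV[R]_N) j : g (c *m A) (e j) = c 0 j.
  rewrite mulmx_sum_row; under eq_bigr do rewrite rowK.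
  rewrite (linear_for_sum (g_lin _)) (bigD1 j) //= ee eqxx mulr1 big1 ?addr0 // => i /negbTE ij.
  by rewrite ee ij mulr0.
have Aunit : A \in unitmx.
  rewrite -row_free_unit; apply/row_freeP; apply: contrapT => nA.
  have : (kermx A != 0).
    apply/eqP => k0; apply: nA; apply/row_freeP.
    by rewrite -kermx_eq0 k0.
  case/rowV0Pn => c /sub_kermxP cA /eqP; apply; apply/rowP => j.
  by rewrite -coef cA mxE (linear_for0 (g_lin _)).
have wE : w = (w *m invmx A) *m A by rewrite mulmxKV.
rewrite {1}wE mulmx_sum_row; apply: eq_bigr => i _.
by rewrite rowK {2}wE coef.
Qed.

End OrthonormalExpansion.

(** Adding [nu] completes the family to a basis. *)
Lemma orthonormal_hyperplane (R : realType) (N : nat)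
    (g : 'rV[R]_N -> 'rV[R]_N -> R) (e : 'I_N.-1 -> 'rV[R]_N) (nu : 'rV[R]_N) :
  (0 < N)%N -> (forall w, linear_for *%R (g^~ w)) ->
  (forall u v, g u v = g v u) ->
  (forall i j, g (e i) (e j) = (i == j)%:R) ->
  (forall i, g nu (e i) = 0) -> g nu nu = 1 ->
  forall w, \sum_i g w (e i) *: e i = w - g w nu *: nu.
Proof.
case: N g e nu => // N g e nu _ g_lin gC ee nue nunu w /=.
pose e' i := if unlift ord0 i is Some j then e j else nu.
have e'0 : e' ord0 = nu by rewrite /e' unlift_none.
have e'S j : e' (lift ord0 j) = e j by rewrite /e' liftK.
have h : (forall i j, g (e' i) (e' j) = (i == j)%:R) ->
    \sum_(i < N) g w (e i) *: e i = w - g w nu *: nu.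
  move=> /(@orthonormal_basis _ _ g g_lin) /(_ w); rewrite big_ord_recl e'0 => h.
  apply/eqP; rewrite eq_sym subr_eq; apply/eqP; rewrite {1}h addrC; congr (_ + _).
  by apply: eq_bigr => j _; rewrite e'S.
apply: h => i j; case: (unliftP ord0 i) => [i'|] ->; case: (unliftP ord0 j) => [j'|] ->;
  rewrite ?e'0 ?e'S ?ee ?nue ?nunu ?eqxx //.
by rewrite gC nue.
Qed.

(** The right-hand side no longer involves the frame, but only its normal [W],
    which is not normalized here. *)
Lemma orthonormal_trace (R : realType) (N : nat)
    (g : 'rV[R]_N -> 'rV[R]_N -> R) (e : 'I_N.-1 -> 'rV[R]_N) (W : 'rV[R]_N)
    (phi : 'rV[R]_N -> R) :
  (0 < N)%N -> (forall w, linear_for *%R (g^~ w)) ->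
  (forall u v, g u v = g v u) ->
  (forall i j, g (e i) (e j) = (i == j)%:R) ->
  (forall i, g W (e i) = 0) -> 0 < g W W -> linear_for *%R phi ->
  forall w, \sum_i phi (e i) * g w (e i) = phi w - g w W / g W W * phi W.
Proof.
move=> N0 glin gC ee eW q0 philin w; set q := g W W in q0 *.
pose nu := (Num.sqrt q)^-1 *: W.
have gZl a u v : g (a *: u) v = a * g u v by rewrite (linear_forZ (glin v)).
have gZr a u v : g u (a *: v) = a * g u v by rewrite !(gC u) gZl.
have qE : (Num.sqrt q)^-1 * (Num.sqrt q)^-1 = q^-1.
  by rewrite -invfM -expr2 sqr_sqrtr // ltW.
have nunu : g nu nu = 1 by rewrite gZl gZr mulrA qE mulVf // gt_eqF.
have nue i : g nu (e i) = 0 by rewrite gZl eW mulr0.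
have h := orthonormal_hyperplane N0 glin gC ee nue nunu w.
under eq_bigr do rewrite mulrC.
rewrite -(linear_for_sum philin) h (linear_forD philin) -scaleN1r !(linear_forZ philin).
by rewrite gZr mulN1r -qE; congr (_ - _); ring.
Qed.

(** * The equation of a bisector *)
Section BisectorEquation.
Variables (R : realType) (n : nat).
Implicit Types (x p : qvec R n).

(** Below 1 the square root is truncated to 0, and [arccosh] still increases. *)
Lemma arccosh_lt (s t : R) : 0 < s -> s < t -> arccosh s < arccosh t.
Proof.
move=> s0 st; have t0 := lt_trans s0 st.
have pos (r : R) : 0 < r -> 0 < r + Num.sqrt (r ^+ 2 - 1).
  by move=> r0; rewrite ltr_pwDl // sqrtr_ge0.
rewrite /arccosh ltr_ln ?posrE ?pos // ltr_leD // ler_wsqrtr // lerD2r.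
by rewrite lerXn2r ?nnegrE ?ltW.
Qed.

Lemma arccosh_inj (s t : R) : 0 < s -> 0 < t -> arccosh s = arccosh t -> s = t.
Proof.
move=> s0 t0 e; case: (ltgtP s t) => // st.
  by have := arccosh_lt s0 st; rewrite e ltxx.
by have := arccosh_lt t0 st; rewrite e ltxx.
Qed.

Lemma herm_hlift x p : herm (hlift x) (hlift p) = - (qone R - hprod x p).
Proof. by rewrite hermE /= qmul1r qconj1 opprB. Qed.

Lemma herm_neg_neq0 (X Y : hvec R n) : hsq X < 0 -> hsq Y < 0 -> herm X Y != 0.
Proof.
by move=> X0 Y0; apply/eqP => /(hsq_orth_ge0 X0); rewrite leNgt Y0.
Qed.

(** [arccosh] is injective on positive numbers, and squaring removes the roots. *)
Lemma bisectorP p1 p2 x : qhyp p1 -> qhyp p2 ->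
  bisector p1 p2 x <-> qhyp x /\
    qsq (herm (hlift x) (hlift p1)) * (1 - sqnorm p2) =
    qsq (herm (hlift x) (hlift p2)) * (1 - sqnorm p1).
Proof.
move=> p1B p2B; rewrite /bisector /=.
suff h : qhyp x -> hdist x p1 = hdist x p2 <->
    qsq (herm (hlift x) (hlift p1)) * (1 - sqnorm p2) =
    qsq (herm (hlift x) (hlift p2)) * (1 - sqnorm p1).
  by split=> [] [xB /(h xB)].
move=> xB; rewrite /hdist.
have D0 : 0 < 1 - sqnorm x by rewrite subr_gt0.
have D10 : 0 < 1 - sqnorm p1 by rewrite subr_gt0.
have D20 : 0 < 1 - sqnorm p2 by rewrite subr_gt0.
have ratio p : qhyp p -> let r := qnorm (qone R - hprod x p)
    / Num.sqrt ((1 - sqnorm x) * (1 - sqnorm p)) in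
    0 < r /\ r ^+ 2 = qsq (herm (hlift x) (hlift p)) / ((1 - sqnorm x) * (1 - sqnorm p)).
  move=> pB /=; have P0 : 0 < 1 - sqnorm p by rewrite subr_gt0.
  have Q0 : 0 < qsq (qone R - hprod x p).
    rewrite -qsqN -herm_hlift qsq_gt0.
    by apply: herm_neg_neq0; exact/qhyp_hlift.
  rewrite qnormE; split; first by rewrite divr_gt0 // sqrtr_gt0 // mulr_gt0.
  by rewrite expr_div_n !sqr_sqrtr ?ltW // ?mulr_gt0 // herm_hlift qsqN.
have [r1 r1E] := ratio p1 p1B; have [r2 r2E] := ratio p2 p2B.
move: r1 r1E r2 r2E; set a := _ / Num.sqrt _; set b := _ / Num.sqrt _ => a0 aE b0 bE.
transitivity (a = b).
  split=> [e|-> //]; apply: arccosh_inj => //.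
  by apply: (@mulfI _ 2) e; rewrite pnatr_eq0.
transitivity (a ^+ 2 = b ^+ 2).
  split=> [-> //|/eqP]; rewrite eqrXn2 ?ltW // => /eqP //.
rewrite aE bE; split=> [|e].
  move/(congr1 (fun z => z * ((1 - sqnorm x) * (1 - sqnorm p1) * (1 - sqnorm p2)))).
  have -> : forall u v, u / ((1 - sqnorm x) * (1 - sqnorm p1)) *
    ((1 - sqnorm x) * (1 - sqnorm p1) * v) = u * v.
    by move=> u v; field; rewrite !gt_eqF.
  move=> ->; field; by rewrite !gt_eqF.
apply/eqP; rewrite eqr_div ?mulf_neq0 ?(gt_eqF D0) ?(gt_eqF D10) ?(gt_eqF D20) //; apply/eqP.
by rewrite !(mulrCA _ (1 - sqnorm x)) e.
Qed.

End BisectorEquation.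

(** * Stability properties of analytic functions *)
Section AnalyticAt.
Variables (R : realType) (N : nat) (a : 'rV[R]_N).
Implicit Types (G H : 'rV[R]_N -> R) (f g : 'rV[R]_N -> quat R).

Definition expandable G : Prop := analytic0 (fun h => G (a + h)).

Lemma expandable_const c : expandable (fun=> c).
Proof. exact: analytic0_const. Qed.

Lemma expandableD G H : expandable G -> expandable H -> expandable (fun x => G x + H x).
Proof. exact: analytic0D. Qed.

Lemma expandableM G H : expandable G -> expandable H -> expandable (fun x => G x * H x).
Proof. exact: analytic0M. Qed.

Lemma expandableN G : expandable G -> expandable (fun x => - G x).
Proof.
move=> aG; have := expandableM (expandable_const (-1)) aG.
by congr expandable; apply/funext => x; rewrite mulN1r.
Qed.

Lemma expandableV G : expandable G -> G a != 0 -> expandable (fun x => (G x)^-1).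
Proof. by move=> aG Ga; apply: analytic0V aG _; rewrite addr0. Qed.

Lemma expandable_cos G : expandable G -> expandable (fun x => cos (G x)).
Proof. by move=> /analytic0_cos_sin[]. Qed.

Lemma expandable_sin G : expandable G -> expandable (fun x => sin (G x)).
Proof. by move=> /analytic0_cos_sin[]. Qed.

Lemma expandable_sum (I : Type) (s : seq I) (G : I -> 'rV[R]_N -> R) :
  (forall i, expandable (G i)) -> expandable (fun x => \sum_(i <- s) G i x).
Proof.
move=> aG; elim: s => [|i s IH].
  by under [X in expandable X]eq_fun do rewrite big_nil; exact: expandable_const.
by under [X in expandable X]eq_fun do rewrite big_cons; exact: expandableD.
Qed.

Lemma expandable_linear G : linear_for *%R G -> expandable G.
Proof.
move=> Glin; have -> : G = fun x => \sum_(i < N) x 0 i * G (delta_mx 0 i).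
  by apply/funext => x; exact: linear_forE.
apply: expandable_sum => i; apply: expandableM; last exact: expandable_const.
rewrite /expandable; under [X in analytic0 X]eq_fun do rewrite mxE.
by apply: analytic0D; [exact: analytic0_const | exact: analytic0_coord].
Qed.

Definition qexpandable f : Prop := forall k, (k < 4)%N -> expandable (fun x => qcoord (f x) k).

Lemma qexpandable_conj f : qexpandable f -> qexpandable (fun x => qconj (f x)).
Proof.
move=> af [|[|[|[|//]]]] _; rewrite /qconj; under [X in expandable X]eq_fun do rewrite qE.
all: by repeat (exact: af || apply: expandableN).
Qed.

Lemma qexpandableM f g : qexpandable f -> qexpandable g -> qexpandable (fun x => f x ** g x).
Proof.
move=> af ag; have h i j : (i < 4)%N -> (j < 4)%N ->
    expandable (fun x => qcoord (f x) i * qcoord (g x) j).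
  by move=> i4 j4; apply: expandableM; [exact: af | exact: ag].
move=> [|[|[|[|//]]]] _; rewrite /qmul; under [X in expandable X]eq_fun do rewrite qE.
all: by repeat (apply: expandableD || apply: expandableN); exact: h.
Qed.

Lemma expandable_qsq f : qexpandable f -> expandable (fun x => qsq (f x)).
Proof. by move=> af; exact: (qexpandableM (qexpandable_conj af) af (k := 0)). Qed.

Lemma qexpandable_inv f : qexpandable f -> f a != 0 -> qexpandable (fun x => qinv (f x)).
Proof.
move=> af fa k k4; rewrite /qinv; under [X in expandable X]eq_fun do rewrite qcoordZ.
apply: expandableM; last exact: qexpandable_conj.
by apply: expandableV; [exact: expandable_qsq | rewrite qsq_eq0].
Qed.

Lemma expandable_helicoid_fun (t : 'rV[R]_N -> R) f : expandable t -> qexpandable f ->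
  expandable (fun x => helicoid_fun (t x) (f x)).
Proof.
move=> at_ af; rewrite /helicoid_fun.
apply: expandableD; last apply: expandableN.
all: apply: expandableM; try exact: af.
  by apply: expandable_cos; apply: expandableM => //; exact: af.
by apply: expandable_sin; apply: expandableM => //; exact: af.
Qed.

End AnalyticAt.

(** * The helicoids over a quaternionic line *)
Section NullPair.
Variables (R : realType) (n : nat) (E F : hvec R n).
Hypotheses (EE : herm E E = 0) (FF : herm F F = 0) (EF : herm E F = qone R).
Implicit Types (X : hvec R n) (x u : qvec R n) (c v : quat R).

(** Homogeneous coordinates of the orthogonal projection of a point to the
    quaternionic line spanned by [E] and [F]. The quotient of the two is a
    half-space coordinate on that line, [F] being the point at infinity. *)
Definition coE X := herm E X.
Definition coF X := herm F X.
Definition halfsp X := coE X ** qinv (coF X).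

Let FE : herm F E = qone R. Proof. by rewrite -herm_conj EF qconj1. Qed.

(** The component [Y] of [X] orthogonal to [E] and [F] is orthogonal to the
    negative vector [Z = E - F], hence nonnegative. What remains of the norm of
    [X] is twice the scalar product of its two coordinates. *)
Lemma re_coE_coF_lt0 X : hsq X < 0 -> qdot (coE X) (coF X) < 0.
Proof.
move=> Xneg; set l := coE X; set m := coF X.
pose Z := hadd E (hscale F (- qone R)).
have Zneg : hsq Z < 0.
  by rewrite hsqD hsq_scale /hsq EE FF herm_scaler EF qmul1l qreN qre1 qre0; lra.
pose Y := hadd X (hscale (hadd (hscale F l) (hscale E m)) (- qone R)).
have EY : herm E Y = 0.
  rewrite !(hermDr, herm_scaler, EE, EF) -/(coE X) -/l qmul0l addr0 qmul1l.
  by rewrite qmulNr qmul1r subrr.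
have FY : herm F Y = 0.
  rewrite !(hermDr, herm_scaler, FF, FE) -/(coF X) -/m qmul0l add0r qmul1l.
  by rewrite qmulNr qmul1r subrr.
have ZY : herm Z Y = 0 by rewrite hermDl herm_scalel EY FY qmul0r addr0.
have := hsq_orth_ge0 Zneg ZY.
rewrite !(hsqD, hsq_scale, herm_scaler, herm_scalel) hermDr !herm_scaler FE qmul1r.
rewrite -!(herm_conj _ X) -/(coE X) -/(coF X) -/l -/m {2 3}/hsq EE FF.
rewrite qre0 qsqN qsq1 qmulNr qmul1r qreN qreD -!/(qdot _ _) (qdotC m l).
lra.
Qed.

Lemma coF_neq0 X : hsq X < 0 -> coF X != 0.
Proof.
move=> /re_coE_coF_lt0 h; apply/eqP => m0; move: h; rewrite m0.
by rewrite qdotE !qcoord0 !mulr0 !addr0 ltxx.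
Qed.

Lemma coE_halfsp X : coF X != 0 -> coE X = halfsp X ** coF X.
Proof. by move=> m0; rewrite /halfsp -qmulA qmulVq // qmul1r. Qed.

Lemma halfsp_re_lt0 X : hsq X < 0 -> qre (halfsp X) < 0.
Proof.
move=> Xneg; have m0 := coF_neq0 Xneg; have N0 := m0; rewrite -qsq_gt0 in N0.
have := re_coE_coF_lt0 Xneg; rewrite coE_halfsp //.
rewrite -{2}(qmul1l (coF X)) qdot_mul2r pmulr_rlt0 // qdotC.
by rewrite /qdot qconj1 qmul1l.
Qed.

Lemma coE_scale X q : coE (hscale X q) = coE X ** q.
Proof. exact: herm_scaler. Qed.

Lemma coF_scale X q : coF (hscale X q) = coF X ** q.
Proof. exact: herm_scaler. Qed.

Lemma halfsp_scale X q : coF X != 0 -> q != 0 -> halfsp (hscale X q) = halfsp X.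
Proof.
move=> m0 q0; rewrite /halfsp coE_scale coF_scale qinvM // qmulA.
by rewrite -(qmulA _ q) qmulqV // qmul1r.
Qed.

Definition comb (a b : quat R) : hvec R n := hadd (hscale E a) (hscale F b).

Lemma herm_comb X a b : herm X (comb a b) = qconj (coE X) ** a + qconj (coF X) ** b.
Proof. by rewrite hermDr !herm_scaler -!(herm_conj _ X). Qed.

(** The vector of the plane of [E] and [F] that is orthogonal to [X]
    ([herm_hor]) and along which [halfsp] moves in the direction [c]
    ([dhalfsp_hor_field]). *)
Definition hor c X : hvec R n :=
  comb (c ** coF X) (- (qconj (halfsp X) ** c ** coF X)).

Lemma hermE_hor c X : herm E (hor c X) = - (qconj (halfsp X) ** c ** coF X).
Proof. by rewrite /hor /comb hermDr !herm_scaler EE EF qmul0l add0r qmul1l. Qed.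

Lemma hermF_hor c X : herm F (hor c X) = c ** coF X.
Proof. by rewrite /hor /comb hermDr !herm_scaler FE FF qmul0l addr0 qmul1l. Qed.

Lemma herm_hor c X : coF X != 0 -> herm X (hor c X) = 0.
Proof.
by move=> m0; rewrite herm_comb {1}coE_halfsp // qconjM !qmulNr !qmulA subrr.
Qed.

Definition dcoE u := hprod E.1 u.
Definition dcoF u := hprod F.1 u.
Definition dhalfsp x u := (dcoE u - halfsp (hlift x) ** dcoF u) ** qinv (coF (hlift x)).

Lemma dcoE_dhalfsp x u : coF (hlift x) != 0 ->
  dcoE u = dhalfsp x u ** coF (hlift x) + halfsp (hlift x) ** dcoF u.
Proof. by move=> m0; rewrite /dhalfsp -qmulA qmulVq // qmul1r subrK. Qed.

Definition hor_field c x : qvec R n :=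
  (hor c (hlift x)).1 - qscale x (hor c (hlift x)).2.

Lemma hprod_comb a b u :
  hprod (comb a b).1 u = qconj a ** dcoE u + qconj b ** dcoF u.
Proof. by rewrite hprodDl !hprod_scalel. Qed.

Lemma qre_hor c X u : coF X != 0 ->
  qre (hprod (hor c X).1 u) = qdot (c ** coF X) (dcoE u - halfsp X ** dcoF u).
Proof.
move=> m0; rewrite hprod_comb qreD -!/(qdot _ _).
by rewrite qdotNl qdotDr qdotNr -qmulA (qdot_mull (qconj (halfsp X))) qconjK.
Qed.

Lemma metric_hor_field c x u : qhyp x ->
  metric x (hor_field c x) u = 4 * qsq (coF (hlift x)) / (1 - sqnorm x) * qdot c (dhalfsp x u).
Proof.
move=> xB; have m0 := coF_neq0 ((qhyp_hlift x).1 xB).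
rewrite /hor_field metric_horizontal //; last exact: herm_hor.
rewrite qre_hor // (dcoE_dhalfsp u m0) addrK qdot_mul2r.
ring.
Qed.

Lemma dcoE_horizontal x G : dcoE (G.1 - qscale x G.2) = herm E G - coE (hlift x) ** G.2.
Proof.
rewrite /dcoE /coE !hermE /= hprodDr hprodNr hprod_scaler qmul1r qmulBl.
by rewrite opprB addrA addrNK.
Qed.

Lemma dcoF_horizontal x G : dcoF (G.1 - qscale x G.2) = herm F G - coF (hlift x) ** G.2.
Proof.
rewrite /dcoF /coF !hermE /= hprodDr hprodNr hprod_scaler qmul1r qmulBl.
by rewrite opprB addrA addrNK.
Qed.

Lemma dcoF_hor_field c x : dcoF (hor_field c x) =
  c ** coF (hlift x) - coF (hlift x) ** (hor c (hlift x)).2.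
Proof. by rewrite dcoF_horizontal hermF_hor. Qed.

Lemma dhalfsp_hor_field c x : qhyp x ->
  dhalfsp x (hor_field c x) = - (2 * qre (halfsp (hlift x))) *: c.
Proof.
move=> xB; have m0 := coF_neq0 ((qhyp_hlift x).1 xB).
rewrite /dhalfsp dcoE_horizontal dcoF_hor_field hermE_hor coE_halfsp //.
set y := halfsp _; set m := coF _; set g := _.2.
have -> : - (qconj y ** c ** m) - y ** m ** g - y ** (c ** m - m ** g) =
      (- (2 * qre y) *: c) ** m.
  rewrite qmulBr !qmulA opprB addrA subrK -qmulNl -qmulBl.
  by congr (_ ** _); qring.
by rewrite -qmulA qmulqV // qmul1r.
Qed.

Lemma metric_hor_fields c d x : qhyp x -> metric x (hor_field c x) (hor_field d x) =
  - (8 * qsq (coF (hlift x)) * qre (halfsp (hlift x)) / (1 - sqnorm x)) * qdot c d.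
Proof. by move=> xB; rewrite metric_hor_field // dhalfsp_hor_field // qdotZr; ring. Qed.

Lemma has_diff_herm_hlift (G : hvec R n) p :
  has_diff (fun x => herm G (hlift x)) p (fun u => hprod G.1 u).
Proof.
rewrite (_ : (fun x => _) = fun x => hprod G.1 x + - (qconj G.2)).
  apply: has_diff_eq (has_diffD (has_diff_hprodr G.1 p) (has_diff_cst _ p)) _.
  by move=> u; rewrite addr0.
by apply/funext => x; rewrite hermE /= qmul1r.
Qed.

Lemma has_diff_halfsp p : qhyp p ->
  has_diff (fun x => halfsp (hlift x)) p (dhalfsp p).
Proof.
move=> pB; have m0 := coF_neq0 ((qhyp_hlift p).1 pB).
have hm := has_diff_herm_hlift F p.
have := has_diff_qmul (has_diff_herm_hlift E p) (has_diff_qinv m0 hm).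
move/has_diff_eq; apply => u; rewrite /dhalfsp qmulBl /halfsp qmulNr !qmulA.
by rewrite /dcoE /dcoF /coE /coF.
Qed.

(** The derivative along [u] of [hor v] at a lifted point, where [vd] is the
    derivative of [v]. *)
Definition dhor (p : qvec R n) v vd u : hvec R n :=
  let m := coF (hlift p) in let y := halfsp (hlift p) in
  comb (vd ** m + v ** dcoF u)
       (- (qconj (dhalfsp p u) ** v ** m + qconj y ** vd ** m + qconj y ** v ** dcoF u)).

Lemma has_diff_hor_field (v dv : qvec R n -> quat R) p : qhyp p -> has_diff v p dv ->
  has_diff (fun x => hor_field (v x) x) p
    (fun u => (dhor p (v p) (dv u) u).1 - qscale u (hor (v p) (hlift p)).2
              - qscale p (dhor p (v p) (dv u) u).2).
Proof.
move=> pB hv; have hy := has_diff_halfsp pB; have hm := has_diff_herm_hlift F p.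
have ha := has_diff_qmul hv hm.
have hg := has_diffN (has_diff_qmul (has_diff_qmul (has_diff_qconj hy) hv) hm).
have hE1 := has_diff_qscale (has_diff_cst E.1 p) ha.
have hF1 := has_diff_qscale (has_diff_cst F.1 p) hg.
have hE2 := has_diff_qmul (has_diff_cst E.2 p) ha.
have hF2 := has_diff_qmul (has_diff_cst F.2 p) hg.
have hx := has_diff_qscale (has_diff_id p) (has_diffD hE2 hF2).
have := has_diffD (has_diffD hE1 hF1) (has_diffN hx).
move/has_diff_eq; apply => u.
rewrite /dhor /hor /= -!/(dcoF _) -!/(coF _).
have subD (a b c : qvec R n) : a - (b + c) = a - b - c by rewrite opprD addrA.
by rewrite !qscale0l !qmul0l !add0r !qmulDl; exact: subD.
Qed.

(** Up to the factor [1 - |x|^2], this is [coF] of the horizontal lift of [u], the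
    component of [(u, 0)] orthogonal to the lift of [x]. *)
Definition lift_dcoF x u : quat R := (1 - sqnorm x) *: dcoF u + coF (hlift x) ** hprod x u.

(** The covariant derivative of [hor_field v] along [u], expressed in the
    half-space coordinate; [vd] is the derivative of [v] along [u]. *)
Definition shape_q x v vd u : quat R :=
  let m := coF (hlift x) in
  ((1 - sqnorm x) * qsq m) *: vd + v ** lift_dcoF x u ** qconj m - v ** m ** qconj (lift_dcoF x u).

Lemma nabla_hor_field x v vd u : qhyp x ->
  metric x ((dhor x v vd u).1 - qscale u (hor v (hlift x)).2
              - qscale x (dhor x v vd u).2) u
    + 2^-1 * dmetric x u (hor_field v x)
  = 4 / (1 - sqnorm x) ^+ 2 * qdot (shape_q x v vd u) (dhalfsp x u).
Proof.
move=> xB; have m0 := coF_neq0 ((qhyp_hlift x).1 xB).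
rewrite covariant_horizontal //; last exact: herm_hor.
congr (_ * _); rewrite /shape_q /lift_dcoF -(nabla_algebra _ (halfsp (hlift x))).
rewrite -(dcoE_dhalfsp u m0) -coE_halfsp //.
rewrite -(hprod_conj (hor v _).1 u) !hprod_comb herm_comb -(hprod_conj x u).
by rewrite qreD.
Qed.

Lemma linear_qcoord_shape x (v : quat R) (dv : quat R -> quat R) k :
  (forall j : nat, linear_for *%R (fun z => qcoord (dv z) j)) ->
  linear_for *%R (fun u => qcoord (shape_q x v (dv (dhalfsp x u)) u) k).
Proof.
move=> dvlin a u w.
have ylin j : qcoord (dhalfsp x (a *: u + w)) j =
    a * qcoord (dhalfsp x u) j + qcoord (dhalfsp x w) j.
  rewrite -qcoordZ -qcoordD; congr (qcoord _ j).
  rewrite /dhalfsp /dcoE /dcoF !hprodDr !hprodZr qmulDr qmulZr opprD addrACA -scalerBr.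
  by rewrite (qmulDl (a *: _)) qmulZl.
have zlin : dv (dhalfsp x (a *: u + w)) = a *: dv (dhalfsp x u) + dv (dhalfsp x w).
  have -> : dhalfsp x (a *: u + w) = a *: dhalfsp x u + dhalfsp x w.
    by apply: qcoord_inj; rewrite qcoordD qcoordZ ylin.
  by apply: qcoord_inj; rewrite qcoordD qcoordZ dvlin.
have Mlin : lift_dcoF x (a *: u + w) = a *: lift_dcoF x u + lift_dcoF x w.
  rewrite /lift_dcoF /dcoF !hprodDr !hprodZr qmulDr qmulZr scalerDr scalerDr !scalerA.
  by rewrite [_ * a]mulrC addrACA.
rewrite -qcoordZ -qcoordD; congr (qcoord _ k); rewrite /shape_q zlin Mlin.
rewrite qconjD qconjZ !(qmulDr, qmulDl, qmulZr, qmulZl).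
have lin3 (s : R) (A B C A' B' C' : quat R) :
    s *: (a *: A + A') + (a *: B + B') - (a *: C + C') =
    a *: (s *: A + B - C) + (s *: A' + B' - C').
  by apply/rowP => j; rewrite !mxE; ring.
exact: lin3.
Qed.

Lemma helicoid_hess_linear (t : R) y (j : nat) :
  linear_for *%R (fun z => qcoord (helicoid_hess t y z) j).
Proof.
move=> a z w; rewrite -qcoordZ -qcoordD; congr (qcoord _ j).
by rewrite /helicoid_hess; qring.
Qed.

Lemma lift_dcoF_hor_field x c : qhyp x ->
  lift_dcoF x (hor_field c x) = (1 - sqnorm x) *: (c ** coF (hlift x)).
Proof.
move=> xB; have m0 := coF_neq0 ((qhyp_hlift x).1 xB).
rewrite /lift_dcoF dcoF_hor_field /hor_field hprod_affine_orth; last exact: herm_hor.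
by rewrite qmulZr -scalerDr subrK.
Qed.

Lemma shape_hor_field x v dv c : qhyp x ->
  shape_q x v (dv (dhalfsp x (hor_field c x))) (hor_field c x) =
  ((1 - sqnorm x) * qsq (coF (hlift x))) *:
    (dv (- (2 * qre (halfsp (hlift x))) *: c) + v ** (c - qconj c)).
Proof.
move=> xB; rewrite /shape_q lift_dcoF_hor_field // dhalfsp_hor_field //.
rewrite qconjZ !(qmulZr, qmulZl) qconjM.
rewrite !qmulA -!(qmulA _ (coF _)) qmul_conjr !qmulZr !qmulZl !scalerA !qmul1r.
by rewrite -addrA -scalerBr -qmulBr -scalerDr.
Qed.

Definition helicoid (t : R) : set (qvec R n) :=
  [set x | qhyp x /\ helicoid_fun t (halfsp (hlift x)) = 0].

Definition grad_field t x : qvec R n := hor_field (helicoid_grad t (halfsp (hlift x))) x.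

Lemma qsq_helicoid_grad_gt0 (t : R) y : 0 < qsq (helicoid_grad t y).
Proof.
rewrite qsqE /helicoid_grad !qE sqrrN -addrA cos2Dsin2 expr0n add0r.
by rewrite ltr_wpDl // sqr_ge0.
Qed.

Lemma metric_grad_field t x : qhyp x -> metric x (grad_field t x) (grad_field t x) =
  - (8 * qsq (coF (hlift x)) * qre (halfsp (hlift x)) / (1 - sqnorm x))
    * qsq (helicoid_grad t (halfsp (hlift x))).
Proof. by move=> xB; rewrite metric_hor_fields. Qed.

Lemma metric_grad_field_gt0 t x : qhyp x -> 0 < metric x (grad_field t x) (grad_field t x).
Proof.
move=> xB; rewrite metric_grad_field // pmulr_lgt0 ?qsq_helicoid_grad_gt0 //.
have xneg := (qhyp_hlift x).1 xB; have y0 := halfsp_re_lt0 xneg.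
have N0 : 0 < qsq (coF (hlift x)) by rewrite qsq_gt0 coF_neq0.
have D0 : 0 < 1 - sqnorm x by rewrite subr_gt0.
rewrite oppr_gt0 pmulr_llt0 ?invr_gt0 // pmulr_rlt0 //; lra.
Qed.

(** The coordinates of [dhalfsp] on the frame are metric products with the
    horizontal fields of the basis quaternions, so that Parseval turns the sum
    over the frame into a sum over that basis, minus the contribution of the
    normal. Both vanish. *)
Lemma trace_shape_q t p (e : 'I_(n * 4).-1 -> qvec R n) : (0 < n)%N ->
  helicoid t p -> (forall i j, metric p (e i) (e j) = (i == j)%:R) ->
  (forall i, metric p (grad_field t p) (e i) = 0) ->
  \sum_i qdot (shape_q p (helicoid_grad t (halfsp (hlift p)))
    (helicoid_hess t (halfsp (hlift p)) (dhalfsp p (e i))) (e i)) (dhalfsp p (e i)) = 0.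
Proof.
move=> n0 [pB pM] ee eW.
set y := halfsp (hlift p) in pM *; set v := helicoid_grad t y; set W := grad_field t p in eW *.
pose Phi u := shape_q p v (helicoid_hess t y (dhalfsp p u)) u.
have Philin j : linear_for *%R (fun u => qcoord (Phi u) j).
  by apply: linear_qcoord_shape => k; exact: helicoid_hess_linear.
have q0 := metric_grad_field_gt0 t pB; rewrite -/W in q0.
set q := metric p W W in q0.
have glin w : linear_for *%R ((metric p)^~ w) by move=> a u1 u2; exact: metric_linear.
have N0 : (0 < n * 4)%N by rewrite muln_gt0 n0.
have pars j w := orthonormal_trace N0 glin (metricC p) ee eW q0 (Philin j) w.
have m0 : coF (hlift p) != 0 := coF_neq0 ((qhyp_hlift p).1 pB).
have qm0 : qsq (coF (hlift p)) != 0 by rewrite qsq_eq0.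
have D0 : 1 - sqnorm p != 0 by rewrite gt_eqF // subr_gt0.
pose k := (1 - sqnorm p) / (4 * qsq (coF (hlift p))).
pose K := 8 * qsq (coF (hlift p)) * qre y / (1 - sqnorm p).
have yW j u : (j < 4)%N -> qcoord (dhalfsp p u) j = k * metric p (hor_field (qbasis R j) p) u.
  by move=> j4; rewrite metric_hor_field // qdot_qbasis // /k; field; rewrite ?qm0 ?D0.
pose psi c := helicoid_hess t y (- (2 * qre y) *: c) + v ** (c - qconj c).
pose s := (1 - sqnorm p) * qsq (coF (hlift p)).
have PhiW c : Phi (hor_field c p) = s *: psi c.
  exact: (shape_hor_field v (helicoid_hess t y) c pB).
have PhiWv : Phi W = s *: psi v by exact: PhiW.
have sumj j : (j < 4)%N ->
    \sum_i qcoord (Phi (e i)) j * qcoord (dhalfsp p (e i)) j =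
    k * (s * qcoord (psi (qbasis R j)) j + K / q * (qcoord v j * (s * qcoord (psi v) j))).
  move=> j4; under eq_bigr do rewrite yW // mulrCA.
  rewrite -mulr_sumr pars metric_hor_fields // -/v qdot_qbasis // -/y -/K -/q PhiW PhiWv.
  by rewrite !qcoordZ !mulNr opprK (mulrAC K) -!mulrA.
change (\sum_i qdot (Phi (e i)) (dhalfsp p (e i)) = 0).
have [] := helicoid_trace0 (- (2 * qre y)) pM.
rewrite -/v -!/(psi _) qdotE => tr0 nor0.
clear - sumj tr0 nor0; clearbody Phi K k q v psi s.
under eq_bigr do rewrite qdotE.
rewrite 3!big_split /= (sumj 0%N) // (sumj 1%N) // (sumj 2%N) // (sumj 3%N) //.
transitivity (k * s * (qcoord (psi (qbasis R 0)) 0 + qcoord (psi (qbasis R 1)) 1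
    + qcoord (psi (qbasis R 2)) 2 + qcoord (psi (qbasis R 3)) 3)
  + k * (K / q) * s * (qcoord v 0 * qcoord (psi v) 0 + qcoord v 1 * qcoord (psi v) 1
    + qcoord v 2 * qcoord (psi v) 2 + qcoord v 3 * qcoord (psi v) 3)); first by ring.
by rewrite tr0 nor0 !mulr0 addr0.
Qed.

Lemma has_diff_f t p : qhyp p ->
  has_diff (fun x => helicoid_fun t (halfsp (hlift x))) p
    (fun u => qdot (helicoid_grad t (halfsp (hlift p))) (dhalfsp p u)).
Proof. by move=> pB; apply: has_diff_helicoid_fun; exact: has_diff_halfsp. Qed.

Lemma metric_grad_field_diff t p u : qhyp p -> metric p (grad_field t p) u =
  4 * qsq (coF (hlift p)) / (1 - sqnorm p)
    * qdot (helicoid_grad t (halfsp (hlift p))) (dhalfsp p u).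
Proof. by move=> pB; rewrite metric_hor_field. Qed.

Lemma tangent_grad_field t p u : qhyp p -> tangent (helicoid t) p u ->
  metric p (grad_field t p) u = 0.
Proof.
move=> pB [gam [gam0 gamd gamM]]; rewrite metric_grad_field_diff //.
have [fd fE] := has_diff_f t pB.
set f := (fun x => _) in fd fE.
have gd : differentiable gam (0 : R) by apply/derivable1_diffP; exact: ex_derive.
have f0 : differentiable f (gam 0) by rewrite gam0.
have -> : qdot (helicoid_grad t (halfsp (hlift p))) (dhalfsp p u) = 'D_1 (f \o gam) (0 : R).
  rewrite deriveE; last exact: differentiable_comp.
  rewrite (diff_comp gd f0) /= gam0.
  by rewrite -(deriveE _ gd) derive_val fE.
rewrite (@near_eq_derive _ _ _ _ (fun=> (0 : R))) ?derive_cst ?mulr0 //.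
by near=> s; have [] : helicoid t (gam s) by near: s.
Unshelve. all: by end_near. Qed.

Lemma dmetric_linear x u a w z : dmetric x u (a *: w + z) = a * dmetric x u w + dmetric x u z.
Proof.
rewrite /dmetric !(hprodDl, hprodDr, hprodZl, hprodZr, qdotDr, qdotZr, qreD, qreZ).
ring.
Qed.

Lemma minimal_helicoid t p : (0 < n)%N -> helicoid t p ->
  exists nu : qvec R n -> qvec R n,
    [/\ differentiable nu p,
        \forall x \near p, helicoid t x -> unit_normal (helicoid t) x (nu x) &
        forall e, orthonormal_frame (helicoid t) p e -> mean_curvature nu p e = 0].
Proof.
move=> n0 pM; have [pB fp] := pM.
pose Q x := - (8 * qsq (coF (hlift x)) * qre (halfsp (hlift x)) / (1 - sqnorm x))
    * qsq (helicoid_grad t (halfsp (hlift x))).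
have QE x : qhyp x -> metric x (grad_field t x) (grad_field t x) = Q x by exact: metric_grad_field.
pose lam x := (Num.sqrt (Q x))^-1.
pose nu x := lam x *: grad_field t x.
have Q0 x : qhyp x -> 0 < Q x by move=> xB; rewrite -QE // metric_grad_field_gt0.
have hy := has_diff_halfsp pB; have hm := has_diff_herm_hlift F p.
have hv := has_diff_helicoid_grad hy t.
have D0 : 1 - sqnorm p != 0 by rewrite gt_eqF // subr_gt0.
have hD := has_diffD (has_diff_cst (1 : R) p) (has_diffN (has_diff_sqnorm p)).
have [dQ hQ] : exists dQ, has_diff Q p dQ.
  have hN := has_diffM (has_diff_cst (8 : R) p) (has_diff_qsq hm).
  have hNy := has_diffM hN (has_diff_qcoord 0 hy).
  have hV := @has_diffV _ _ (fun x => 1 - sqnorm x) _ p D0 hD.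
  have h := has_diffM (has_diffN (has_diffM hNy hV)) (has_diff_qsq hv).
  by eexists; exact: h.
have [dlam hlam] : exists dlam, has_diff lam p dlam.
  have hs := has_diff_comp hQ (is_derive1_sqrt (Q0 p pB)).
  have s0 : Num.sqrt (Q p) != 0 by rewrite gt_eqF // sqrtr_gt0 Q0.
  by eexists; exact: (@has_diffV _ _ (fun x => Num.sqrt (Q x)) _ p s0 hs).
have hW := has_diff_hor_field pB hv.
have hnu := has_diffZ hlam hW; rewrite -/(grad_field t p) in hnu.
exists nu; split.
- by have [] := hnu.
- near=> x; move=> [xB fx]; split.
    rewrite /nu (linear_forZ (fun a u w => metric_linear x _ a u w)) metricC.
    rewrite (linear_forZ (fun a u w => metric_linear x _ a u w)) QE // /lam mulrA.
    by rewrite -invfM -expr2 sqr_sqrtr ?mulVf ?gt_eqF ?ltW // Q0.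
  move=> v vT; rewrite /nu (linear_forZ (fun a u w => metric_linear x _ a u w)).
  by rewrite tangent_grad_field // mulr0.
move=> e [eT ee].
have eW i : metric p (grad_field t p) (e i) = 0 by rewrite tangent_grad_field.
have lZ a u w : metric p (a *: u) w = a * metric p u w.
  exact: (linear_forZ (fun a u w' => metric_linear p w a u w')).
have cov i : covder nu p (e i) (e i) = lam p * (4 / (1 - sqnorm p) ^+ 2 *
    qdot (shape_q p (helicoid_grad t (halfsp (hlift p)))
           (helicoid_hess t (halfsp (hlift p)) (dhalfsp p (e i))) (e i)) (dhalfsp p (e i))).
  rewrite -nabla_hor_field // -/(grad_field t p) /covder (has_diff_derive (e i) hnu).
  rewrite metric_linear eW mulr0 add0r lZ christoffel_diag derive_metric // /nu.
  have dZ a w : dmetric p (e i) (a *: w) = a * dmetric p (e i) w.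
    exact: (linear_forZ (dmetric_linear p (e i))).
  by rewrite dZ [RHS]mulrDr (mulrCA 2^-1).
rewrite /mean_curvature /second_fundamental_form.
under eq_bigr do rewrite cov.
by rewrite sumrN -!mulr_sumr trace_shape_q // !mulr0 oppr0.
Unshelve. all: by end_near. Qed.

(** Moves [X] parallel to the plane of [E] and [F] until its coordinates there are
    [l] and [m]. *)
Definition recoord X (l m : quat R) : hvec R n := hadd X (comb (m - coF X) (l - coE X)).

Lemma coE_recoord X l m : coE (recoord X l m) = l.
Proof.
by rewrite /coE /recoord /comb !hermDr !herm_scaler EE EF qmul0l add0r qmul1l addrC subrK.
Qed.

Lemma coF_recoord X l m : coF (recoord X l m) = m.
Proof.
by rewrite /coF /recoord /comb !hermDr !herm_scaler FE FF qmul0l addr0 qmul1l addrC subrK.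
Qed.

Lemma hsq_recoord X l m : hsq (recoord X l m) = hsq X + 2 * (qdot l m - qdot (coE X) (coF X)).
Proof.
have hc a b : hsq (comb b a) = 2 * qdot b a.
  rewrite /comb hsqD !hsq_scale /hsq EE FF qre0 !mul0r !add0r.
  by rewrite herm_scaler herm_scalel EF qmul1r.
rewrite /recoord hsqD hc herm_comb qreD -!/(qdot _ _) -addrA -mulrDr; congr (_ + 2 * _).
rewrite -{3}(subrK (coE X) l) -{3}(subrK (coF X) m).
rewrite (qdotDl (l - _)) !(qdotDr _ (m - _)) (qdotC (l - _)) (qdotC (l - _) (coF X)).
ring.
Qed.

Lemma recoord_id X : recoord X (coE X) (coF X) = X.
Proof.
rewrite /recoord /comb !subrr /hadd /hscale /= !qmul0r.
have q0 (x : qvec R n) : qscale x 0 = 0 by rewrite -(scale0r 0) qscaleZr scale0r.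
by rewrite !q0 !addr0; case: X.
Qed.

Lemma combD a b c d : hadd (comb a b) (comb c d) = comb (a + c) (b + d).
Proof. by rewrite /comb /hadd /hscale /= !qscaleDr !qmulDr addrACA [in X in (_, X)]addrACA. Qed.

Lemma recoord_recoord X l m l' m' : recoord (recoord X l m) l' m' = recoord X l' m'.
Proof.
rewrite {1}/recoord coE_recoord coF_recoord /recoord haddA combD.
by rewrite [m - _ + _]addrC [l - _ + _]addrC !subrKA.
Qed.

Lemma recoord_scale X l m q : recoord (hscale X q) (l ** q) (m ** q) = hscale (recoord X l m) q.
Proof.
rewrite /recoord coE_scale coF_scale -!qmulBl hscaleDl; congr hadd.
by rewrite /comb hscaleDl !hscaleA.
Qed.

Lemma halfsp_eq X y : coF X != 0 -> coE X = y ** coF X -> halfsp X = y.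
Proof. by move=> m0 e; rewrite /halfsp e -qmulA qmulqV // qmul1r. Qed.

(** In the half-space coordinate, [y] is projected to [y_2 = 0] and then conjugated
    by [spin t y]. Multiplying [coF] by the same unit, and keeping the real part
    of [y], preserves the norm of [X] ([hsq_twist]). *)
Definition twist t X : hvec R n :=
  let y := halfsp X in let u := spin t y in
  recoord X (u ** (y - qcoord y 2 *: qbasis R 2) ** coF X) (u ** coF X).

Lemma spin_conj_mul (t : R) y : qconj (spin t y) ** spin t y = qone R.
Proof. by rewrite qmul_conjl qsq_spin scale1r. Qed.

Lemma spin_neq0 (t : R) y : spin t y != 0.
Proof. by rewrite -qsq_eq0 qsq_spin oner_eq0. Qed.

Lemma qmul_neq0 (p q : quat R) : p != 0 -> q != 0 -> p ** q != 0.
Proof. by rewrite -!qsq_gt0 qsqM => ? ?; rewrite mulr_gt0. Qed.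

Lemma hsq_twist t X : coF X != 0 -> hsq (twist t X) = hsq X.
Proof.
move=> m0; rewrite hsq_recoord -qmulA qdot_mul2l qsq_spin mul1r coE_halfsp //.
set y := halfsp X; set m := coF X.
rewrite -[X in qdot _ X - _]qmul1l -[X in _ - qdot _ X]qmul1l !qdot_mul2r -mulrBr.
rewrite -[RHS]addr0; congr (_ + _); rewrite !qdotE /qbasis !qE /=; ring.
Qed.

Lemma twist_helicoid t X : hsq X < 0 -> helicoid t (aff (twist t X)).
Proof.
move=> Xneg; have m0 := coF_neq0 Xneg; set y := halfsp X; set u := spin t y.
have um0 : u ** coF X != 0 by rewrite qmul_neq0 // spin_neq0.
set y' := u ** (y - qcoord y 2 *: qbasis R 2) ** qconj u.
have ly : coE (twist t X) = y' ** (u ** coF X).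
  rewrite /twist coE_recoord -/y -/u /y' -!qmulA; congr (_ ** (_ ** _)).
  by rewrite qmulA spin_conj_mul qmul1l.
have my : coF (twist t X) = u ** coF X by rewrite coF_recoord.
have neg : hsq (twist t X) < 0.
  by rewrite hsq_twist.
split; first exact: qhyp_aff.
rewrite hlift_aff ?hsq_neg_neq0 // halfsp_scale ?my ?qinv_neq0 ?hsq_neg_neq0 //.
by rewrite (@halfsp_eq _ y') ?my // /y' helicoid_fun_twist.
Qed.

(** Turning [z] back by the inverse spin gives a point with [y_2 = 0] and the same
    [y_1], hence the same spin. *)
Lemma twist_onto t z : helicoid t z -> exists x, qhyp x /\ z = aff (twist t (hlift x)).
Proof.
move=> [zB fz]; have Zneg := (qhyp_hlift z).1 zB; set Z := hlift z in Zneg fz *.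
have m0 := coF_neq0 Zneg; set y := halfsp Z in fz; pose u := spin t y.
pose X := recoord Z (qconj u ** y ** coF Z) (qconj u ** coF Z).
have cu0 : qconj u ** coF Z != 0 by rewrite qmul_neq0 // -qsq_eq0 qsq_conj qsq_spin oner_eq0.
have Xneg : hsq X < 0.
  by rewrite hsq_recoord -qmulA qdot_mul2l qsq_conj qsq_spin mul1r -coE_halfsp // subrr mulr0 addr0.
have X2 := hsq_neg_neq0 Xneg; set q := qinv X.2; have q0 : q != 0 by rewrite qinv_neq0.
have xE : hlift (aff X) = hscale X q by rewrite hlift_aff.
have mX : coF X = qconj u ** coF Z by rewrite coF_recoord.
have uu : u ** qconj u = qone R by rewrite qmul_conjr qsq_spin scale1r.
have yX : halfsp X = qconj u ** y ** u.
  apply: halfsp_eq; rewrite mX // /X coE_recoord [RHS]qmulA.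
  by rewrite -(qmulA (qconj u ** y) u) uu qmul1r.
exists (aff X); split; first exact: qhyp_aff.
have yx : halfsp (hlift (aff X)) = qconj u ** y ** u by rewrite xE halfsp_scale // mX.
rewrite /twist yx spin_untwist -/u // helicoid_fun_untwist // scale0r subr0 xE coF_scale mX.
have -> : u ** (qconj u ** y ** u) ** (qconj u ** coF Z ** q) = coE Z ** q.
  by rewrite !qmulA uu qmul1l -(qmulA y) uu qmul1r -coE_halfsp.
have -> : u ** (qconj u ** coF Z ** q) = coF Z ** q.
  by rewrite !qmulA uu qmul1l.
rewrite recoord_scale recoord_recoord recoord_id aff_scale ?aff_hlift //.
by rewrite -qsq_eq0 qsq1 oner_eq0.
Qed.

Lemma continuous_twist t x : qhyp x -> {for x, continuous (fun z => aff (twist t (hlift z)))}.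
Proof.
move=> xB; have hy := has_diff_halfsp xB; have hm := has_diff_herm_hlift F x.
have hl := has_diff_herm_hlift E x; have [du hu] := has_diff_spin hy t.
have hp := has_diffD hy (has_diffN (has_diffZ (has_diff_qcoord 2 hy)
  (has_diff_cst (qbasis R 2) x))).
have hl' := has_diff_qmul (has_diff_qmul hu hp) hm.
have hm' := has_diff_qmul hu hm.
have da := has_diffD hm' (has_diffN hm); have db := has_diffD hl' (has_diffN hl).
have h1 := has_diffD (has_diff_id x) (has_diffD (has_diff_qscale (has_diff_cst E.1 x) da)
   (has_diff_qscale (has_diff_cst F.1 x) db)).
have h2 := has_diffD (has_diff_cst (qone R) x) (has_diffD (has_diff_qmul (has_diff_cst E.2 x) da)
   (has_diff_qmul (has_diff_cst F.2 x) db)).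
have Xneg := (qhyp_hlift x).1 xB.
have n2 : (twist t (hlift x)).2 != 0.
  by apply: hsq_neg_neq0; rewrite hsq_twist // coF_neq0.
have h := has_diff_qscale h1 (@has_diff_qinv _ _ (fun z => (twist t (hlift z)).2) _ x n2 h2).
exact: differentiable_continuous (proj1 h).
Qed.

Lemma near_qhyp (p : qvec R n) : qhyp p -> \forall x \near p, qhyp x.
Proof.
move=> pB; have [/differentiable_continuous sc _] := has_diff_sqnorm p.
apply: (sc [set s | s < 1]); apply: open_nbhs_nbhs; split; last exact: pB.
exact: open_lt.
Qed.

Lemma connected_qhyp : connected (@qhyp R n).
Proof.
have -> : @qhyp R n = \bigcup_(x in @qhyp R n) ((fun s : R => s *: x) @` `[0, 1]).
  apply/seteqP; split=> [x xB|_ [x xB [s /= s01 <-]]].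
    by exists x => //; exists 1; rewrite ?scale1r //= in_itv /= ler01 lexx.
  move: s01; rewrite in_itv /= => /andP[s0 s1].
  move: xB; rewrite /qhyp /= sqnormZ; apply: le_lt_trans.
  by rewrite ler_piMl ?sqnorm_ge0 // exprn_ile1.
apply: bigcup_connected.
  exists 0 => x xB; exists 0; rewrite ?scale0r //=.
  by rewrite in_itv /= lexx ler01.
move=> x xB; apply: connected_continuous_connected; first exact: segment_connected.
by apply: continuous_subspaceT => s; exact: scalel_continuous.
Qed.

(** Connectedness of the helicoid is read off from this description. *)
Lemma helicoidE t : helicoid t = (fun x => aff (twist t (hlift x))) @` (@qhyp R n).
Proof.
apply/seteqP; split=> [z /twist_onto[x [xB ->]]|_ [x xB <-]]; first by exists x.
by apply: twist_helicoid; exact/qhyp_hlift.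
Qed.

Lemma connected_helicoid t : connected (helicoid t).
Proof.
rewrite helicoidE; apply: connected_continuous_connected; first exact: connected_qhyp.
apply/subspace_continuousP => x xB; apply: cvg_within_filter.
exact: continuous_twist.
Qed.

Lemma helicoid_neq0 t : helicoid t !=set0.
Proof.
rewrite helicoidE; exists (aff (twist t (hlift 0))); exists 0 => //.
by rewrite /qhyp /= /sqnorm -(scale0r (0 : qvec R n)) hprodZl scale0r qre0 ltr01.
Qed.

Lemma derive_grad_field t p : helicoid t p ->
  'D_(grad_field t p) (fun x => helicoid_fun t (halfsp (hlift x))) p != 0.
Proof.
move=> [pB fp]; rewrite (has_diff_derive _ (has_diff_f t pB)).
have := metric_grad_field_gt0 t pB; rewrite metric_grad_field_diff //.
by case: eqP => // ->; rewrite mulr0 ltxx.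
Qed.

Lemma qexpandable_halfsp (N : nat) (xi : 'rV[R]_N -> qvec R n) (a : 'rV[R]_N) :
  (forall (c : R) z w, xi (c *: z + w) = c *: xi z + xi w) -> qhyp (xi a) ->
  qexpandable a (fun z => halfsp (hlift (xi z))).
Proof.
move=> xilin aB.
have aherm (G : hvec R n) : qexpandable a (fun z => herm G (hlift (xi z))).
  move=> k k4; under [X in expandable _ X]eq_fun do rewrite hermE /= qmul1r qcoordD.
  apply: expandableD; last exact: expandable_const.
  by apply: expandable_linear => c z w; rewrite xilin hprodDr hprodZr qcoordD qcoordZ.
apply: qexpandableM; first exact: aherm.
apply: qexpandable_inv; first exact: aherm.
by apply: coF_neq0; exact/qhyp_hlift.
Qed.

Lemma hypersurface_helicoid t : hypersurface (helicoid t).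
Proof.
split.
- by move=> x [].
- exact: helicoid_neq0.
- exact: connected_helicoid.
move=> p pB; exists (fun x => helicoid_fun t (halfsp (hlift x))); split.
- apply: analytic0_at.
  apply: (@expandable_helicoid_fun _ _ p (fun=> t) (fun x => halfsp (hlift x))).
    exact: expandable_const.
  exact: (@qexpandable_halfsp _ id).
- by near=> x; split=> [[]|fx] //; split=> //; near: x; exact: near_qhyp.
- by move=> pM; exists (grad_field t p); exact: derive_grad_field.
Unshelve. all: by end_near. Qed.

Lemma analytic_family_helicoid : analytic_family helicoid.
Proof.
move=> t p pB; pose eqn (z : 'rV[R]_(1 + n * 4)) :=
  helicoid_fun (lsubmx z 0 0) (halfsp (hlift (rsubmx z))) : R.
have rK : rsubmx (row_mx t%:M p : 'rV[R]_(1 + n * 4)) = p by rewrite row_mxKr.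
exists eqn; split.
- apply: analytic0_at; apply: (@expandable_helicoid_fun _ _ _ (fun z => lsubmx z 0 0)
    (fun z : 'rV[R]_(1 + n * 4) => halfsp (hlift (rsubmx z)))).
    by apply: expandable_linear => c z w; rewrite !mxE.
  apply: qexpandable_halfsp; last by rewrite rK.
  by move=> c z w; rewrite !linearP.
- have : \forall z \near (row_mx t%:M p : 'rV[R]_(1 + n * 4)), qhyp (rsubmx z).
    have /differentiable_continuous rc :=
      @differentiable_rsubmx R 1 1 (n * 4) (row_mx t%:M p).
    by apply: rc; rewrite rK; exact: near_qhyp.
  by apply: filterS => z zB; split=> [[]|].
- move=> pM; exists (grad_field t p); have := derive_grad_field pM; rewrite /derive.
  set v := grad_field t p; set f := (fun x => helicoid_fun t (halfsp (hlift x))).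
  suff -> : (fun h : R => h^-1 *: ((f \o shift p) (h *: v) - f p)) =
    (fun h : R => h^-1 *: ((eqn \o shift (row_mx t%:M p)) (h *: row_mx 0 v)
                           - eqn (row_mx t%:M p))) by [].
  apply/funext => h; congr (_ *: (_ - _)); last first.
    by rewrite /eqn rK row_mxKl mxE eqxx.
  rewrite /eqn /= scale_row_mx add_row_mx scaler0 add0r row_mxKr row_mxKl.
  by rewrite mxE eqxx.
Qed.

(** The inverse of the half-space coordinate on the quaternionic line. *)
Definition axis_pt (y : quat R) : qvec R n := aff (comb (qone R) y).

Let axisE (y : quat R) : (coE (comb (qone R) y) = y) * (coF (comb (qone R) y) = qone R) *
  (hsq (comb (qone R) y) = 2 * qre y).
Proof.
rewrite /coE /coF /comb !hermDr !herm_scaler EE FF EF FE !qmul0l !qmul1l add0r addr0.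
split=> //; rewrite hsqD !hsq_scale /hsq EE FF qre0 !mul0r !add0r.
by rewrite herm_scaler herm_scalel EF qconj1 !qmul1l.
Qed.

Lemma helicoid_axis t y : qre y < 0 -> helicoid t (axis_pt y) <-> helicoid_fun t y = 0.
Proof.
move=> y0; have neg : hsq (comb (qone R) y) < 0 by rewrite axisE pmulr_rlt0.
have n2 := hsq_neg_neq0 neg; have q0 := qinv_neq0 n2.
have one0 : qone R != 0 by rewrite -qsq_eq0 qsq1 oner_eq0.
have -> : helicoid t (axis_pt y) <->
    qhyp (axis_pt y) /\ helicoid_fun t (halfsp (hlift (axis_pt y))) = 0 by [].
rewrite /axis_pt hlift_aff // halfsp_scale ?axisE //.
rewrite (@halfsp_eq _ y) ?axisE ?qmul1r //.
by split=> [[]|] //; split=> //; exact: qhyp_aff.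
Qed.

(** On the line, the product of the point with a fixed vector is affine in
    [qconj y], so that its square norm is a real polynomial with quadratic part
    proportional to [qsq y]. *)
Lemma bisector_axis p1 p2 : qhyp p1 -> qhyp p2 ->
  exists (r s : R) (b : quat R), forall y, qre y < 0 ->
    bisector p1 p2 (axis_pt y) <-> r * qsq y + qdot b y + s = 0.
Proof.
move=> p1B p2B; set P1 := hlift p1; set P2 := hlift p2.
pose D1 := 1 - sqnorm p1; pose D2 := 1 - sqnorm p2.
pose a1 := herm E P1; pose b1 := herm F P1; pose a2 := herm E P2; pose b2 := herm F P2.
exists (D2 * qsq b1 - D1 * qsq b2), (D2 * qsq a1 - D1 * qsq a2),
  (2 *: (D2 *: (b1 ** qconj a1) - D1 *: (b2 ** qconj a2))) => y y0.
have neg : hsq (comb (qone R) y) < 0 by rewrite axisE pmulr_rlt0.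
have n2 := hsq_neg_neq0 neg; have q0 := qinv_neq0 n2.
have hP P : herm (hlift (axis_pt y)) P =
    qconj (qinv (comb (qone R) y).2) ** (herm E P + qconj y ** herm F P).
  rewrite /axis_pt hlift_aff // herm_scalel; congr (_ ** _).
  by rewrite hermDl !herm_scalel qconj1 qmul1l.
have sq (a b : quat R) : qsq (a + qconj y ** b) =
    qsq b * qsq y + 2 * qdot (b ** qconj a) y + qsq a.
  by rewrite -(qsq_conj y); qring.
rewrite bisectorP // !hP !qsqM !sq -/D1 -/D2 -/P1 -/P2 -/a1 -/a2 -/b1 -/b2 qsq_conj.
move: (qsq_gt0 (qinv (comb (qone R) y).2)); rewrite q0 => c0.
set c := qsq (qinv _) in c0 *.
rewrite qdotZl qdotDl qdotNl !qdotZl.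
have cn : c != 0 by rewrite gt_eqF.
split=> [[_ /eqP]|e].
  rewrite -!mulrA (inj_eq (mulfI cn)) => /eqP; clear; clearbody a1 b1 a2 b2 D1 D2.
  by move=> e; lra.
split; first exact: qhyp_aff.
by rewrite -!mulrA; congr (_ * _); move: e; clear; clearbody a1 b1 a2 b2 D1 D2 => e; lra.
Qed.

(** The equation of a bisector vanishing on the helicoid is identically zero on
    the line, which would force the whole line into the helicoid. *)
Lemma helicoid_not_bisector t : t != 0 -> ~ is_bisector (helicoid t).
Proof.
move=> t0 [p1 [p2 [p1B p2B _ E12]]].
have [r [s [b bP]]] := bisector_axis p1B p2B; rewrite -E12 in bP.
have zero y : qre y < 0 -> helicoid_fun t y = 0 -> r * qsq y + qdot b y + s = 0.
  by move=> y0 fy; apply/(bP y y0)/(helicoid_axis t y0).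
have zeroc y0 y1 y2 y3 : y0 < 0 -> y2 * cos (t * y1) - y3 * sin (t * y1) = 0 ->
    r * (y0 ^+ 2 + y1 ^+ 2 + y2 ^+ 2 + y3 ^+ 2)
    + (qcoord b 0 * y0 + qcoord b 1 * y1 + qcoord b 2 * y2 + qcoord b 3 * y3) + s = 0.
  move=> y00 fy; have := zero (mkquat y0 y1 y2 y3).
  by rewrite /helicoid_fun /qre qsqE qdotE !qE; apply.
(* Every helicoid contains the half-plane [y_2 = y_3 = 0]. *)
have flat y0 y1 : y0 < 0 -> r * (y0 ^+ 2 + y1 ^+ 2) + (qcoord b 0 * y0 + qcoord b 1 * y1) + s = 0.
  move=> y00; have := @zeroc y0 y1 0 0 y00; rewrite !mul0r subr0 => /(_ erefl).
  by rewrite expr0n /= !mulr0 !addr0.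
have h1 := @flat (-1) 0 (ltrN10 R).
have h2 := @flat (-2) 0 ltac:(by rewrite oppr_lt0).
have h3 := @flat (-3) 0 ltac:(by rewrite oppr_lt0).
have h4 := @flat (-1) 1 (ltrN10 R).
have r0 : r = 0 by lra.
have s0 : s = 0 by lra.
have b0 : qcoord b 0 = 0 by lra.
have b1 : qcoord b 1 = 0 by lra.
have b3 : qcoord b 3 = 0.
  have := @zeroc (-1) 0 0 1 (ltrN10 R); rewrite mulr0 sin0 mulr0 mul0r subrr => /(_ erefl).
  by rewrite r0 s0 b0 !mul0r !mulr0 !add0r mulr1 addr0.
(* At this height the ruling has turned by a right angle. *)
have b2 : qcoord b 2 = 0.
  have := @zeroc (-1) (pi / 2 / t) 1 0 (ltrN10 R).
  rewrite (mulrC t) divfK // cos_pihalf mulr0 mul0r subrr => /(_ erefl).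
  by rewrite r0 s0 b0 b1 !mul0r !mulr0 !add0r mulr1 !addr0.
pose y := mkquat (-1) 0 1 0 : quat R.
have y0 : qre y < 0 by rewrite /y /qre qE ltrN10.
have : helicoid t (axis_pt y).
  by apply/(bP y y0); rewrite r0 s0 qdotE b0 b1 b2 b3 !mul0r !addr0.
move/(helicoid_axis t y0); rewrite /helicoid_fun /y !qE mulr0 cos0 mulr1 mul0r subr0 => /eqP.
by rewrite oner_eq0.
Qed.

End NullPair.

(** * Bisectors as members of the family *)
Section NormalForm.
Variables (R : realType) (n : nat).
Implicit Types (X Y Z : hvec R n) (p : qvec R n).

Lemma qsq_hermC X Y : qsq (herm X Y) = qsq (herm Y X).
Proof. by rewrite -herm_conj qsq_conj. Qed.

(** Real factors adjust the norms of the lifts, and a unit quaternion makes their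
    product real and negative. The bound on [k] is the reversed Cauchy-Schwarz
    inequality, strict for distinct points. *)
Lemma normalized_lifts p1 p2 : qhyp p1 -> qhyp p2 -> p1 <> p2 ->
  exists (Q1 Q2 : hvec R n) (k : R),
    [/\ hsq Q1 = -1, hsq Q2 = -1, herm Q1 Q2 = - k *: qone R, 1 < k &
        forall X, qsq (herm Q1 X) * (1 - sqnorm p1) = qsq (herm X (hlift p1)) /\
                  qsq (herm Q2 X) * (1 - sqnorm p2) = qsq (herm X (hlift p2))].
Proof.
move=> p1B p2B p12; set P1 := hlift p1; set P2 := hlift p2.
have P1neg : hsq P1 < 0 by exact/qhyp_hlift.
have P2neg : hsq P2 < 0 by exact/qhyp_hlift.
set D1 := 1 - sqnorm p1; set D2 := 1 - sqnorm p2.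
have D10 : 0 < D1 by rewrite subr_gt0.
have D20 : 0 < D2 by rewrite subr_gt0.
set w := herm P1 P2; set W := qsq w.
have W0 : 0 < W by rewrite qsq_gt0 herm_neg_neq0.
have hP1 : hsq P1 = - D1 by rewrite hsq_hlift /D1 opprB.
have hP2 : hsq P2 = - D2 by rewrite hsq_hlift /D2 opprB.
pose c1 := (Num.sqrt D1)^-1; pose c2 := (Num.sqrt (W * D2))^-1.
have c10 : 0 < c1 by rewrite invr_gt0 sqrtr_gt0.
have c20 : 0 < c2 by rewrite invr_gt0 sqrtr_gt0 mulr_gt0.
have c1E : c1 ^+ 2 = D1^-1 by rewrite exprVn sqr_sqrtr // ltW.
have c2E : c2 ^+ 2 = (W * D2)^-1 by rewrite exprVn sqr_sqrtr // ltW // mulr_gt0.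
(* The factor [qconj w] makes the product of the lifts real. *)
pose q1 := c1 *: qone R; pose q2 := - c2 *: qconj w.
have q1E : qsq q1 = D1^-1 by rewrite qsqZ qsq1 mulr1.
have q2E : qsq q2 = D2^-1.
  by rewrite qsqZ qsq_conj -/W sqrrN c2E; field; rewrite !gt_eqF.
pose Q1 := hscale P1 q1; pose Q2 := hscale P2 q2; pose k := c1 * c2 * W.
have hQ1 : hsq Q1 = -1 by rewrite hsq_scale hP1 q1E mulNr divff // gt_eqF.
have hQ2 : hsq Q2 = -1 by rewrite hsq_scale hP2 q2E mulNr divff // gt_eqF.
have hQ12 : herm Q1 Q2 = - k *: qone R.
  rewrite herm_scaler herm_scalel -/w /q1 /q2 qconjZ qconj1 !(qmulZl, qmulZr) qmul1l.
  by rewrite qmul_conjr -/W !scalerA /k; congr (_ *: _); ring.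
have k0 : 0 < k by rewrite !mulr_gt0.
have q10 : q1 != 0 by rewrite -qsq_gt0 q1E invr_gt0.
have q20 : q2 != 0 by rewrite -qsq_gt0 q2E invr_gt0.
exists Q1, Q2, k; split=> //; last first.
  move=> X; rewrite !herm_scalel !qsqM !qsq_conj q1E q2E !(qsq_hermC _ X).
  by split; rewrite mulrAC mulVf ?mul1r // gt_eqF.
pose Y := hadd Q2 (hscale Q1 (- k *: qone R)).
have Q1neg : hsq Q1 < 0 by rewrite hQ1 ltrN10.
have Q1Y : herm Q1 Y = 0.
  rewrite hermDr herm_scaler hQ12 herm_self hQ1 qmulZl qmul1l scalerA mulN1r opprK.
  by rewrite -scalerDl addNr scale0r.
have hY : hsq Y = k ^+ 2 - 1.
  rewrite hsqD hsq_scale hQ1 hQ2 herm_scaler -herm_conj hQ12 qsqZ qsq1 !(qconjZ, qconj1).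
  by rewrite qmulZl qmul1l !qreZ qre1; ring.
have k2 : 1 <= k ^+ 2 by rewrite -subr_ge0 -hY; exact: hsq_orth_ge0 Q1Y.
have k1 : 1 <= k by move: k2 k0; clear; clearbody k; nra.
rewrite lt_neqAle k1 andbT; apply/eqP => k1E; apply: p12.
have Y0 : Y = (0, 0) by apply: (hsq_orth_eq0 Q1neg) => //; rewrite hY -k1E expr1n subrr.
have QQ : Q2 = Q1.
  move: Y0; rewrite /Y -k1E scaleN1r /hadd /= qscaleNr qscale1 qmulNr qmul1r => -[e1 e2].
  rewrite (surjective_pairing Q2) (surjective_pairing Q1); congr pair.
    by apply/eqP; rewrite -subr_eq0 e1.
  by apply/eqP; rewrite -subr_eq0 e2.
have one0 : qone R != 0 by rewrite -qsq_eq0 qsq1 oner_eq0.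
by rewrite -(aff_hlift p1) -(aff_hlift p2) -/P1 -/P2 -(@aff_scale _ _ P1 q1) //
  -(@aff_scale _ _ P2 q2) // -/Q1 -/Q2 QQ.
Qed.

(** Equidistance from the two points means that the products of [X] with the
    normalized lifts have equal norms. The null vectors are chosen so that the
    difference of these squared norms becomes a multiple of [y_2]. *)
Lemma null_pair_bisector p1 p2 : qhyp p1 -> qhyp p2 -> p1 <> p2 ->
  exists E F : hvec R n, [/\ herm E E = 0, herm F F = 0, herm E F = qone R &
    bisector p1 p2 = helicoid E F 0].
Proof.
move=> p1B p2B p12; have [Q1 [Q2 [k [h1 h2 h12 k1 hX]]]] := normalized_lifts p1B p2B p12.
(* [E] and [F] are [a (Q1 - Q2) - c (Q1 + Q2) j] and [a (Q1 - Q2) + c (Q1 + Q2) j],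
   where [a (Q1 - Q2)] and [c (Q1 + Q2)] are orthogonal of norms 1/2 and -1/2. *)
pose a := (2 * Num.sqrt (k - 1))^-1; pose c := (2 * Num.sqrt (k + 1))^-1.
have km : 0 < k - 1 by rewrite subr_gt0.
have kp : 0 < k + 1 by rewrite addr_gt0 // (lt_trans ltr01).
have a0 : 0 < a by rewrite invr_gt0 mulr_gt0 // sqrtr_gt0.
have c0 : 0 < c by rewrite invr_gt0 mulr_gt0 // sqrtr_gt0.
have aE : a ^+ 2 * (k - 1) = 4^-1.
  by rewrite exprVn exprMn sqr_sqrtr ?ltW //; field; rewrite gt_eqF.
have cE : c ^+ 2 * (k + 1) = 4^-1.
  by rewrite exprVn exprMn sqr_sqrtr ?ltW //; field; rewrite gt_eqF.
have h21 : herm Q2 Q1 = - k *: qone R by rewrite -herm_conj h12 qconjZ qconj1.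
pose f (q q' : quat R) := hadd (hscale Q1 q) (hscale Q2 q').
have fE q q' r r' : herm (f q q') (f r r') =
    - (qconj q ** r) - (qconj q' ** r') - k *: (qconj q ** r' + qconj q' ** r).
  rewrite !(hermDl, hermDr, herm_scalel, herm_scaler) h12 h21 !herm_self h1 h2.
  rewrite !(qmulDr, qmulZl, qmulZr, qmul1l).
  move: (qconj q ** r) (qconj q' ** r') (qconj q ** r') (qconj q' ** r) => x y z t.
  by apply/rowP => j; rewrite !mxE; ring.
pose E := f (mkquat a 0 (- c) 0) (mkquat (- a) 0 (- c) 0).
pose F := f (mkquat a 0 c 0) (mkquat (- a) 0 c 0).
have EE : herm E E = 0 by rewrite fE; apply: qcoord_inj; qcoords; lra.
have FF : herm F F = 0 by rewrite fE; apply: qcoord_inj; qcoords; lra.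
have EF : herm E F = qone R by rewrite fE; apply: qcoord_inj; qcoords; lra.
exists E, F; split=> //.
apply/seteqP; suff h x : bisector p1 p2 x <-> helicoid E F 0 x by split=> x /h.
rewrite bisectorP //; set X := hlift x.
have [<- <-] := (proj1 (hX X), proj2 (hX X)).
set u1 := herm Q1 X; set u2 := herm Q2 X.
suff h : qhyp x -> helicoid_fun 0 (halfsp E F X) = 0 <-> qsq u1 = qsq u2.
  have D10 : 1 - sqnorm p1 != 0 by rewrite gt_eqF // subr_gt0.
  have D20 : 1 - sqnorm p2 != 0 by rewrite gt_eqF // subr_gt0.
  split=> [[xB e]|[xB /(h xB) ->]]; last by split=> //; ring.
  split=> //; apply/(h xB); apply: (mulIf D10); apply: (mulIf D20).
  by rewrite e; ring.
move=> xB; have m0 := coF_neq0 EE FF EF ((qhyp_hlift x).1 xB).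
have fX q q' : herm (f q q') X = qconj q ** u1 + qconj q' ** u2.
  by rewrite hermDl !herm_scalel.
have y2 : qcoord (coE E X ** qconj (coF F X)) 2 = 2 * a * c * (qsq u1 - qsq u2).
  by rewrite /coE /coF !fX; qring.
rewrite /helicoid_fun mul0r cos0 sin0 mulr1 mulr0 subr0 /halfsp /qinv qmulZr qcoordZ y2.
have N0 : (qsq (coF F X))^-1 != 0 by rewrite invr_eq0 qsq_eq0.
have ac0 : 2 * a * c != 0 by rewrite !mulf_neq0 ?pnatr_eq0 ?gt_eqF.
split=> [/eqP|->]; last by rewrite subrr !mulr0.
by rewrite !mulf_eq0 (negbTE N0) -!mulf_eq0 mulf_eq0 (negbTE ac0) /= subr_eq0 => /eqP.
Qed.

End NormalForm.

(** * Deformation of bisectors *)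

Theorem theorem2 (R : realType) (n : nat) (n_ge1 : (1 <= n)%N)
    (B : set (qvec R n)) (hB : is_bisector B) :
  exists (M : R -> set (qvec R n)) (t0 : R),
    [/\ analytic_family M,
        forall t, minimal_hypersurface (M t),
        M t0 = B &
        forall t, t != t0 -> ~ is_bisector (M t)].
Proof.
have [p1 [p2 [p1B p2B p12 ->]]] := hB.
have [E [F [EE FF EF BE]]] := null_pair_bisector p1B p2B p12.
exists (helicoid E F), 0; split.
- exact: analytic_family_helicoid.
- move=> t; split; first exact: hypersurface_helicoid.
  by move=> p; exact: minimal_helicoid.
- by rewrite BE.
- by move=> t; exact: helicoid_not_bisector.
Qed.
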